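(* Let $\mathfrak g$, $Q_m(\mathfrak g)$ ($m\in\mathbb Z_{>1}$), the cycles $P_{i,\gamma}$, the mutation sequences $R(P)$ and the polynomials $f_X(i,n)$ be as in the context. For $i\in S$ and a cycle $P_{i,\gamma}$, the mutation sequence $R(P_{i,\gamma})$ transforms the seed $(Q_m(\mathfrak g),\mathbf X,\mathbf A)$ into a seed with quiver $Q_m(\mathfrak g)$, and the new variables, written $R(P_{i,\gamma})^\ast(X^j_n)$, $R(P_{i,\gamma})^\ast(A^j_n)$ as rational functions of the initial ones, are as follows. (1) For $j\in S$ with $d_i\ge d_j$ (including $j=i$): $$R(P_{i,\gamma})^\ast(X^j_n)=\begin{cases}\dfrac{f_X(i,n)}{X^i_{n-d_i}\,f_X(i,n-2d_i)} & j=i,\ v^i_n\in P_{i,\gamma},\\[2mm] X^j_n\dfrac{X^i_{n-d_i}f_X(i,n-2d_i)}{f_X(i,n-d_i)} & \text{there is an arrow } v^i_n\to v^j_n,\ v^i_n\in P_{i,\gamma},\\[2mm] X^j_n\dfrac{X^i_{n}f_X(i,n-d_i)}{f_X(i,n)} & \text{there is an arrow } v^j_n\to v^i_n,\ v^i_n\in P_{i,\gamma},\\[2mm] X^j_n\dfrac{X^i_{n-\frac12}f_X(i,n-d_i-\frac12)}{f_X(i,n-\frac12)} & \text{there is an arrow } v^j_n\to v^i_{n-\frac12},\ v^i_{n-\frac12}\in P_{i,\gamma},\\[1mm] X^j_n & \text{otherwise}.\end{cases}$$ When $d_i<d_j$ (then $d_i=d$ and $P_{i,\gamma}=P_i$),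 the only non-trivial actions are $$R(P_i)^\ast(X^j_n)=\begin{cases} X^j_n\dfrac{X^i_{n-\frac12}X^i_nf_X(i,n-1)}{f_X(i,n)} & (i,j)=(\ell,\ell-1)\text{ for }B_\ell,\ (i,j)=(3,2)\text{ for }F_4,\\[2mm] X^\ell_n\dfrac{X^{\ell-1}_nX^{\ell-1}_{n+1}f_X(\ell-1,n-1)}{f_X(\ell-1,n+1)} & (i,j)=(\ell-1,\ell)\text{ for }C_\ell,\\[2mm] X^2_n\dfrac{X^1_nX^1_{n+1}X^1_{n+2}f_X(1,n-1)}{f_X(1,n+2)} & (i,j)=(1,2)\text{ for }G_2,\end{cases}$$ and $R(P_i)^\ast(X^j_n)=X^j_n$ for all other $j$ with $d_i<d_j$. (2) $R(P_{i,\gamma})^\ast(A^j_n)=f_A(i,\gamma)A^j_n$ if $j=i$ and $v^i_n\in P_{i,\gamma}$, and $R(P_{i,\gamma})^\ast(A^j_n)=A^j_n$ otherwise, where $$f_A(i,\gamma)=\sum_{n:\,v^i_n\in P_{i,\gamma}}\frac{1}{A^i_nA^i_{n+d_i}}\prod_{j:\,i\lhd j}A^j_n\prod_{j:\,i\rhd j}A^j_{n+d_i}$$ (here $j\lhd i$ means $j<i$ and $C_{ij}\neq0$, and $i\rhd j$ means $j\lhd i$), except in the following cases $i=\ell-1,\ell$ for $B_\ell$, $i=\ell-1$ for $C_\ell$, $i=2,3$ for $F_4$, $i=1$ for $G_2$, where $$f_A(i,\gamma)=\sum_{n:\,v^i_n\in P_{i,\gamma}}\frac{A^{i+1}_{n+\frac12}A^{i-1}_{n+1}}{A^i_nA^i_{n+1}}\quad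 (i=\ell-1\text{ for }B_\ell,\ i=2\text{ for }F_4),$$ $$f_A(i,1)=\begin{cases}\sum_{n:v^\ell_n\in P_\ell}\dfrac{A^{\ell-1}_{n+\frac12}A^{\ell-1}_n}{A^\ell_nA^\ell_{n+\frac12}} & i=\ell,\ B_\ell,\\[2mm] \sum_{n:v^{\ell-1}_n\in P_{\ell-1}}\dfrac{A^{\ell-2}_{n+1}A^\ell_nA^\ell_{n-1}}{A^{\ell-1}_nA^{\ell-1}_{n+1}} & i=\ell-1,\ C_\ell,\\[2mm] \sum_{n:v^3_n\in P_3}\dfrac{A^2_{n+\frac12}A^2_nA^4_n}{A^3_nA^3_{n+\frac12}} & i=3,\ F_4,\\[2mm] \sum_{n:v^1_n\in P_1}\dfrac{A^2_nA^2_{n-1}A^2_{n-2}}{A^1_nA^1_{n+1}} & i=1,\ G_2.\end{cases}$$ All lower indices are read modulo $d'm$, and $A^j_n$ with $j\notin S$ is interpreted as $1$.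
   Context: Let $\mathfrak g$ be a finite-dimensional complex simple Lie algebra of rank $\ell$, $S=\{1,\dots,\ell\}$, of type $A_\ell$, $B_\ell$, $C_\ell$, $D_\ell$ ($\ell\ge4$), $E_{6,7,8}$, $F_4$ or $G_2$, with simple roots labelled: for $A_\ell,B_\ell,C_\ell$ the Dynkin diagram is the chain $1-2-\cdots-\ell$ ($\alpha_\ell$ short in $B_\ell$, long in $C_\ell$); $D_\ell$: chain $1-\cdots-(\ell-1)$ plus edge $(\ell-2)-\ell$; $E_\ell$: chain $1-2-3-5-6-\cdots-\ell$ plus edge $3-4$; $F_4$: chain $1-2-3-4$ with $\alpha_1,\alpha_2$ long; $G_2$: $\alpha_2$ long. Put $d_i=(\alpha_i,\alpha_i)/2$, normalized so that $d_i=1$ for all $i$ in types $A,D,E$; $(d_i)=(1,\dots,1,\tfrac12)$ for $B_\ell$; $(1,\dots,1,2)$ for $C_\ell$; $(1,1,\tfrac12,\tfrac12)$ for $F_4$; $(1,3)$ for $G_2$. Let $C_{ij}=2(\alpha_i,\alpha_j)/(\alpha_i,\alpha_i)$, $d=\min_id_i$, $d'=\max_id_i$. Quiver $Q(\mathfrak g)$: vertex set $\{v^i_n: i\in S, n\in d\mathbb Z\}$ with arrows, for all $n$: (simply-laced) orient each Dynkin edge from larger to smaller label, giving a quiver $C(\mathfrak g)$; arrows $v^i_n\to v^i_{n+1}$, and for each arrow $i\to j$ of $C(\mathfrak g)$ arrows $v^i_n\to v^j_n$ and $v^j_{n+1}\to v^i_n$. ($B_\ell$, $n\in\frac12\mathbb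 Z$) $v^i_n\to v^i_{n+1}$ for $i\le\ell-1$; $v^i_n\to v^{i-1}_n$, $v^{i-1}_{n+1}\to v^i_n$ for $2\le i\le\ell-1$; $v^\ell_n\to v^\ell_{n+1/2}$, $v^\ell_n\to v^{\ell-1}_{n-1/2}$, $v^{\ell-1}_{n+1/2}\to v^\ell_n$. ($C_\ell$, $n\in\mathbb Z$) $v^i_n\to v^i_{n+1}$ for $i\le\ell-1$; $v^i_n\to v^{i-1}_n$, $v^{i-1}_{n+1}\to v^i_n$ for $2\le i\le\ell-1$; $v^\ell_n\to v^\ell_{n+2}$, $v^\ell_n\to v^{\ell-1}_n$, $v^{\ell-1}_{n+2}\to v^\ell_n$. ($F_4$, $n\in\frac12\mathbb Z$) $v^i_n\to v^i_{n+1}$ ($i=1,2$); $v^2_n\to v^1_n$, $v^1_{n+1}\to v^2_n$; $v^3_n\to v^3_{n+1/2}$, $v^3_n\to v^2_{n-1/2}$, $v^2_{n+1/2}\to v^3_n$; $v^4_n\to v^4_{n+1/2}$, $v^4_n\to v^3_n$, $v^3_{n+1/2}\to v^4_n$. ($G_2$, $n\in\mathbb Z$) $v^1_n\to v^1_{n+1}$, $v^2_n\to v^2_{n+3}$, $v^2_n\to v^1_n$, $v^1_{n+3}\to v^2_n$. For an integer $m>1$, $Q_m(\mathfrak g)$ is the quiver with vertex set $\{v^i_n: i\in S, n\in d\mathbb Z/d'm\mathbb Z\}$ and the same arrows with $n$ read modulo $d'm$. Exchange matrix: $\varepsilon_{uv}=\#\{u\to v\}-\#\{v\to u\}$. Cycles: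 for each $i$ the arrows $v^i_n\to v^i_{n+d_i}$ form $d_i/d$ oriented cycles $P_{i,\gamma}$, $\gamma=1,\dots,d_i/d$: for types $A,D,E$, $P_i=P_{i,1}:v^i_1\to\cdots\to v^i_m\to v^i_1$; for $B_\ell$ and $i<\ell$ (and for $F_4$, $i=1,2$), $P_{i,1}$ runs through integer $n$ and $P_{i,2}$ through $n\in\frac12+\mathbb Z$, while $P_\ell$ (resp. $P_3,P_4$) runs through all $n\in\frac12\mathbb Z/m\mathbb Z$; for $C_\ell$, $P_i$ ($i<\ell$) has length $2m$ and $P_{\ell,k}$ ($k=1,2$) runs through $n\equiv k\pmod 2$; for $G_2$, $P_1$ has length $3m$ and $P_{2,k}$ ($k=1,2,3$) runs through $n\equiv k\pmod 3$. Write $P_i=P_{i,1}$ when $d_i=d$. Seeds and mutation: a seed consists of a quiver with exchange matrix $\varepsilon$ and algebraically independent variables $X_v$, $A_v$ for the vertices $v$. Mutation at $k$: $\varepsilon'_{ij}=-\varepsilon_{ij}$ if $k\in\{i,j\}$, else $\varepsilon_{ij}+(|\varepsilon_{ik}|\varepsilon_{kj}+\varepsilon_{ik}|\varepsilon_{kj}|)/2$; $X'_k=X_k^{-1}$, $X'_i=X_i(1+X_k^{-\mathrm{sgn}(\varepsilon_{ik})})^{-\varepsilon_{ik}}$ ($i\ne k$); $A'_k=A_k^{-1}(\prod_{\varepsilon_{kj}>0}A_j^{\varepsilon_{kj}}+\prod_{\varepsilon_{kj}<0}A_j^{-\varepsilon_{kj}})$, $A'_i=A_i$ ($i\ne k$).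 We write $X^i_n,A^i_n$ for the variables at $v^i_n$. For an oriented cycle $P: v_1\to v_2\to\cdots\to v_p\to v_1$ put $M(P)=\mu_{v_{p-2}}\cdots\mu_{v_2}\mu_{v_1}$ and $R(P)=M(P)^{-1}\circ(v_{p-1},v_p)\circ\mu_{v_p}\mu_{v_{p-1}}\circ M(P)$, where $(v_{p-1},v_p)$ exchanges the two vertex labels. For $v^i_n\in P_{i,\gamma}$ (a cycle of length $p=d'm/d_i$) put $f_X(i,n)=1+\sum_{k=0}^{p-2}X^i_nX^i_{n-d_i}\cdots X^i_{n-kd_i}$. *)

(* Defs.v *)
From mathcomp Require Import all_boot all_order all_algebra.
From mathcomp Require Import mpoly fraction.
Set Implicit Arguments. Unset Strict Implicit. Unset Printing Implicit Defensive.
Import Order.TTheory GRing.Theory Num.Theory.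

(* Vertices v^i_n of Q_m(g) are encoded as pairs (i, t) : nat * int with     *)
(* n = t * d (so t counts time in units of d = min d_i).  Time is taken      *)
(* modulo T = (d'/d) * m, i.e. n modulo d' m.  Canonical representatives     *)
(* have 1 <= i <= l and 0 <= t < T.  In these units, d_i/d = ee k l i, and   *)
(* in types B, F (d = 1/2) a shift by 1/2 is a shift of t by 1.              *)

Inductive ltype := TA | TB | TC | TD | TE | TF | TG.

Definition isB k := if k is TB then true else false.
Definition isC k := if k is TC then true else false.
Definition isF k := if k is TF then true else false.
Definition isG k := if k is TG then true else false.

Definition valid_type (k : ltype) (l : nat) : bool :=
  match k with
  | TA => 1 <= l | TB => 2 <= l | TC => 2 <= l | TD => 4 <= l
  | TE => 6 <= l <= 8 | TF => l == 4 | TG => l == 2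
  end.

Definition unitc (k : ltype) : nat :=
  match k with TB | TC | TF => 2 | TG => 3 | _ => 1 end.

Definition Tn (k : ltype) (m : nat) : nat := unitc k * m.

Definition halfd (k : ltype) : bool := isB k || isF k.

Definition ee (k : ltype) (l i : nat) : nat :=
  match k with
  | TB => if i < l then 2 else 1
  | TC => if i < l then 1 else 2
  | TF => if i <= 2 then 2 else 1
  | TG => if i == 1 then 1 else 3
  | _ => 1
  end.

Definition dynadj (k : ltype) (l i j : nat) : bool :=
  let a := minn i j in let b := maxn i j in
  match k with
  | TD => ((b == a.+1) && (b <= l - 1)) || ((b == l) && (a == l - 2))
  | TE => [|| (a == 1) && (b == 2), (a == 2) && (b == 3), (a == 3) && (b == 4),
              (a == 3) && (b == 5) | (b == a.+1) && (5 <= a)]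
  | _ => b == a.+1
  end && (1 <= a) && (b <= l).

Definition cedge (k : ltype) (l i j : nat) : bool := dynadj k l i j && (j < i).

Definition V := (nat * int)%type.

Definition eqm (T : nat) (a b : int) : bool := (a == b %[mod T])%Z.

Definition narr (k : ltype) (l T : nat) (u v : V) : nat :=
  let: (i, t) := u in let: (j, s) := v in
  match k with
  | TA | TD | TE =>
      nat_of_bool ((i == j) && eqm T s (t + 1)%R)
    + nat_of_bool (cedge k l i j && eqm T s t)
    + nat_of_bool (cedge k l j i && eqm T t (s + 1)%R)
  | TB =>
      nat_of_bool ([&& i == j, 1 <= i, i <= l - 1 & eqm T s (t + 2)%R])
    + nat_of_bool ([&& 2 <= i, i <= l - 1, j == i - 1 & eqm T s t])
    + nat_of_bool ([&& 2 <= j, j <= l - 1, i == j - 1 & eqm T t (s + 2)%R])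
    + nat_of_bool ([&& i == l, j == l & eqm T s (t + 1)%R])
    + nat_of_bool ([&& i == l, j == l - 1 & eqm T s (t - 1)%R])
    + nat_of_bool ([&& i == l - 1, j == l & eqm T t (s + 1)%R])
  | TC =>
      nat_of_bool ([&& i == j, 1 <= i, i <= l - 1 & eqm T s (t + 1)%R])
    + nat_of_bool ([&& 2 <= i, i <= l - 1, j == i - 1 & eqm T s t])
    + nat_of_bool ([&& 2 <= j, j <= l - 1, i == j - 1 & eqm T t (s + 1)%R])
    + nat_of_bool ([&& i == l, j == l & eqm T s (t + 2)%R])
    + nat_of_bool ([&& i == l, j == l - 1 & eqm T s t])
    + nat_of_bool ([&& i == l - 1, j == l & eqm T t (s + 2)%R])
  | TF =>
      nat_of_bool ([&& i == j, 1 <= i, i <= 2 & eqm T s (t + 2)%R])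
    + nat_of_bool ([&& i == 2, j == 1 & eqm T s t])
    + nat_of_bool ([&& i == 1, j == 2 & eqm T t (s + 2)%R])
    + nat_of_bool ([&& i == 3, j == 3 & eqm T s (t + 1)%R])
    + nat_of_bool ([&& i == 3, j == 2 & eqm T s (t - 1)%R])
    + nat_of_bool ([&& i == 2, j == 3 & eqm T t (s + 1)%R])
    + nat_of_bool ([&& i == 4, j == 4 & eqm T s (t + 1)%R])
    + nat_of_bool ([&& i == 4, j == 3 & eqm T s t])
    + nat_of_bool ([&& i == 3, j == 4 & eqm T t (s + 1)%R])
  | TG =>
      nat_of_bool ([&& i == 1, j == 1 & eqm T s (t + 1)%R])
    + nat_of_bool ([&& i == 2, j == 2 & eqm T s (t + 3)%R])
    + nat_of_bool ([&& i == 2, j == 1 & eqm T s t])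
    + nat_of_bool ([&& i == 1, j == 2 & eqm T t (s + 3)%R])
  end.

Definition epsQ (k : ltype) (l T : nat) (u v : V) : int :=
  (Posz (narr k l T u v) - Posz (narr k l T v u))%R.

Definition nrm (T : nat) (u : V) : V := (u.1, (u.2 %% T)%Z).

Definition verts (l T : nat) : seq V :=
  [seq (i, Posz t) | i <- iota 1 l, t <- iota 0 T].

Record seed (K : Type) := Seed {
  seps : V -> V -> int;
  sx : V -> K;
  sa : V -> K }.

Section Mutation.
Local Open Scope ring_scope.
Variable K : fieldType.
Variable vs : seq V.

Definition mutate (kv : V) (s : seed K) : seed K :=
  let e := seps s in
  Seed
    (fun u v => if (u == kv) || (v == kv) then - e u v
                else e u v + ((`|e u kv| * e kv v + e u kv * `|e kv v|) %/ 2)%Z)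
    (fun u => if u == kv then (sx s kv)^-1
              else sx s u * (1 + sx s kv ^ (- sgz (e u kv))) ^ (- e u kv))
    (fun u => if u == kv then
                (sa s kv)^-1 * (\prod_(j <- vs | 0 < e kv j) sa s j ^ e kv j
                                + \prod_(j <- vs | e kv j < 0) sa s j ^ (- e kv j))
              else sa s u).

Definition swapv (a b u : V) : V := if u == a then b else if u == b then a else u.

Definition swap_seed (a b : V) (s : seed K) : seed K :=
  Seed (fun u v => seps s (swapv a b u) (swapv a b v))
       (fun u => sx s (swapv a b u)) (fun u => sa s (swapv a b u)).

Definition mutseq (ws : seq V) (s : seed K) : seed K :=
  foldl (fun s' w => mutate w s') s ws.

(* R(P) for the oriented cycle P = [v_1; ...; v_p]:
   R(P) = M(P)^-1 o (v_{p-1}, v_p) o mu_{v_p} mu_{v_{p-1}} o M(P),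
   M(P) = mu_{v_{p-2}} ... mu_{v_1}. *)
Definition Rmut (P : seq V) (s : seed K) : seed K :=
  let p := size P in
  let a := nth (0%N, 0) P (p - 2) in
  let b := nth (0%N, 0) P (p - 1) in
  let M := take (p - 2) P in
  mutseq (rev M) (swap_seed a b (mutate b (mutate a (mutseq M s)))).

End Mutation.

(* The cycles P_{i,gamma}.  The cycle through v^i_{t0} (in time units of d)  *)
(* is v_c = v^i_{t0 + c e_i}, c = 1..p, p = T / e_i (so v_p = v^i_{t0}).      *)
(* For types A, D, E and t0 = 0 this is v^i_1 -> ... -> v^i_m -> v^i_1.      *)
Definition cyc (k : ltype) (l m i t0 : nat) : seq V :=
  let T := Tn k m in let e := ee k l i in
  [seq nrm T (i, Posz (t0 + e * c)) | c <- iota 1 (T %/ e)].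

(* The initial seed: all X^i_n, A^i_n are distinct indeterminates of the     *)
(* field of rational functions Q(x_0, x_1, ...).                             *)
Definition NV (l T : nat) : nat := (2 * (l * T)).+1.

Definition Kf (l T : nat) : fieldType := {fraction {mpoly rat[NV l T]}}.

Definition xidx (l T : nat) (u : V) : 'I_(NV l T) :=
  inord ((u.1 - 1) * T + `|u.2|%N)%N.
Definition aidx (l T : nat) (u : V) : 'I_(NV l T) :=
  inord (l * T + ((u.1 - 1) * T + `|u.2|%N))%N.

Definition seed0 (k : ltype) (l m : nat) : seed (Kf l (Tn k m)) :=
  let T := Tn k m in
  Seed (epsQ k l T)
       (fun u => FracField.tofrac ('X_(xidx l T u) : {mpoly rat[NV l T]}))
       (fun u => FracField.tofrac ('X_(aidx l T u) : {mpoly rat[NV l T]})).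

Section Formulas.
Local Open Scope ring_scope.
Variable K : fieldType.
Variables (k : ltype) (l m : nat).
Local Notation T := (Tn k m).

Definition fX (x : V -> K) (i : nat) (t : int) : K :=
  let e := ee k l i in
  1 + \sum_(c < (T %/ e).-1) \prod_(q < c.+1) x (nrm T (i, t - Posz (q * e))).

Definition Xnew (i t0 : nat) (x : V -> K) (j : nat) (t : int) : K :=
  let e := ee k l i in
  let ez := (e%:Z) in
  let X j' t' := x (nrm T (j', t')) in
  let f := fX x i in
  let onc t' := eqm e t' t0%:Z in
  let arr j1 t1 j2 t2 := (0 < narr k l T (j1, t1) (j2, t2))%N in
  if (ee k l j <= e)%N then
    if (j == i) && onc t then f t / (X i (t - ez) * f (t - 2 * ez))
    else if onc t && arr i t j t then X j t * (X i (t - ez) * f (t - 2 * ez) / f (t - ez))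
    else if onc t && arr j t i t then X j t * (X i t * f (t - ez) / f t)
    else if [&& halfd k, onc (t - 1) & arr j t i (t - 1)] then
      X j t * (X i (t - 1) * f (t - 1 - ez) / f (t - 1))
    else X j t
  else
    if [&& isB k, i == l & j == (l - 1)%N] || [&& isF k, i == 3%N & j == 2%N] then
      X j t * (X i (t - 1) * X i t * f (t - 2) / f t)
    else if [&& isC k, i == (l - 1)%N & j == l] then
      X j t * (X i t * X i (t + 1) * f (t - 1) / f (t + 1))
    else if [&& isG k, i == 1%N & j == 2%N] then
      X j t * (X i t * X i (t + 1) * X i (t + 2) * f (t - 1) / f (t + 2))
    else X j t.

Definition fA (i t0 : nat) (a : V -> K) : K :=
  let e := ee k l i in
  let ez := (e%:Z) in
  let A j' t' := if (1 <= j' <= l)%N then a (nrm T (j', t')) else 1 in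
  let ts := [seq t%:Z | t <- iota 0 T & eqm e t%:Z t0%:Z] in
  if [&& isB k & i == (l - 1)%N] || [&& isF k & i == 2%N] then
    \sum_(t <- ts) A i.+1 (t + 1) * A i.-1 (t + 2) / (A i t * A i (t + 2))
  else if [&& isB k & i == l] then
    \sum_(t <- ts) A (l - 1)%N (t + 1) * A (l - 1)%N t / (A l t * A l (t + 1))
  else if [&& isC k & i == (l - 1)%N] then
    \sum_(t <- ts) A (l - 2)%N (t + 1) * A l t * A l (t - 1)
                   / (A (l - 1)%N t * A (l - 1)%N (t + 1))
  else if [&& isF k & i == 3%N] then
    \sum_(t <- ts) A 2%N (t + 1) * A 2%N t * A 4%N t / (A 3%N t * A 3%N (t + 1))
  else if [&& isG k & i == 1%N] then
    \sum_(t <- ts) A 2%N t * A 2%N (t - 1) * A 2%N (t - 2) / (A 1%N t * A 1%N (t + 1))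
  else
    \sum_(t <- ts) (A i t * A i (t + ez))^-1
       * \prod_(j <- iota 1 l | dynadj k l i j && (i < j)%N) A j t
       * \prod_(j <- iota 1 l | dynadj k l i j && (j < i)%N) A j (t + ez).

Definition Anew (i t0 : nat) (a : V -> K) (j : nat) (t : int) : K :=
  if (j == i) && eqm (ee k l i) t t0%:Z then fA i t0 a * a (nrm T (j, t))
  else a (nrm T (j, t)).

End Formulas.

(* Main.v *)
(** For a vertex [u] outside the cycle, write [eps (u, w_j) = S_u j - S_u (j-1)]
with [S_u] periodic, nonnegative and vanishing somewhere.  Running through [M(P)],
the remaining vertices [w_(n+1), ..., w_p] always form an oriented cycle, the column of [u]
being governed by the running minimum of [S_u]; at the end [w_(p-1)] and [w_p] are
disconnected and have opposite columns, so that mutating both and exchanging them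
restores the quiver.  Hence it suffices to guess the final seed [t] and to check
that [M(P)] sends [t] to the seed reached from the initial one just before the final
[M(P)^-1] of [R(P)]: mutations are involutive.  With
[g_j = X_j f(j-1) / f(j)] the final variables are [X_j / (g_j g_(j-1))] on the cycle
and [X_u * prod_j g_j ^ S_u(j)] outside it, and the [A]-variables of the cycle are all
multiplied by [sum_j prod_u A_u ^ S_u(j) / (A_j A_(j+1))].  No denominator vanishes,
because all variables lie in the semifield of fractions of polynomials that are positive
at (1, ..., 1). *)

Require Import Defs.
From mathcomp Require Import all_boot all_order all_algebra.
From mathcomp Require Import mpoly fraction.
From mathcomp Require Import zify ring.
Set Implicit Arguments. Unset Strict Implicit. Unset Printing Implicit Defensive.
Import Order.TTheory GRing.Theory Num.Theory.
Local Open Scope ring_scope.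

(** * Positive seeds and mutation *)

(** Guessing the final seed avoids any computation along [M(P)^-1]: the guess has the original
    quiver, so one family of closed formulas for the seed after n mutations applies both to it and
    to the initial seed. These formulas rest on F_n = 1 + X_n + X_n X_(n-1) + ... + X_n ... X_1: the
    variable mutated at step n+1 is X_(n+1) F_n, and one plus it is F_(n+1). Dividing each X_j by
    g_j g_(j-1) multiplies F_n by G_n = 1 / (g_0 ... g_(n-1)), a consequence of the common linear
    recurrence behind f and F. On the A side, a mutated cycle variable is, up to a monomial, a
    partial sum of f_A. The function S_u is a discrete antiderivative of the column of u. In Q_m(g)
    a vertex u over a neighbour j of i has one arrow u -> w_a and one arrow w_(a+r) -> u with r =
    -C_ij, so S_u is the indicator of the window a, ..., a+r-1. Root lengths enter only through r
    and an offset; types are distinguished only when arrows are read off and when windows are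
    expanded into the stated formulas. *)

Notation ppart x := (Num.max x 0).

Record semifield (K : fieldType) (pos : K -> Prop) : Prop := Semifield {
  pos_1 : pos 1;
  pos_add : forall x y, pos x -> pos y -> pos (x + y);
  pos_mul : forall x y, pos x -> pos y -> pos (x * y);
  pos_inv : forall x, pos x -> pos x^-1;
  pos_neq0 : forall x, pos x -> x != 0 }.

Section SemifieldTheory.
Variables (K : fieldType) (pos : K -> Prop).
Hypothesis sfK : semifield pos.

Lemma pos_exprn x n : pos x -> pos (x ^+ n).
Proof.
move=> px; elim: n => [|n IH]; first by rewrite expr0; case: sfK.
by rewrite exprS; apply: (pos_mul sfK).
Qed.

Lemma pos_exprz x (n : int) : pos x -> pos (x ^ n).
Proof.
move=> px; case: n => n; first exact: pos_exprn.
by rewrite NegzE -invr_expz; apply/(pos_inv sfK)/pos_exprn.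
Qed.

Lemma pos_prod (I : Type) (r : seq I) (P : pred I) (F : I -> K) :
  (forall i, pos (F i)) -> pos (\prod_(i <- r | P i) F i).
Proof.
by move=> pF; apply: big_ind => //; [exact: pos_1 sfK | exact: pos_mul sfK].
Qed.

Lemma pos_addsum (I : Type) (r : seq I) (P : pred I) (F : I -> K) x :
  pos x -> (forall i, pos (F i)) -> pos (x + \sum_(i <- r | P i) F i).
Proof.
move=> px pF; elim: r x px => [|i r IH] x px; first by rewrite big_nil addr0.
rewrite big_cons; case: ifP => _; last exact: IH.
by rewrite addrA; apply: IH; apply: (pos_add sfK).
Qed.

End SemifieldTheory.

(** The numerator is 0 when the signs differ and twice [x * |y|] when they agree, so the division is
    exact. In this form the term counts paths through the mutated vertex, one product for each
    direction. *)
Lemma exchange_termE (x y : int) :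
  ((`|x| * y + x * `|y|) %/ 2)%Z =
  ppart x * ppart y - ppart (- x) * ppart (- y).
Proof. nia. Qed.

Lemma exprz_cancel3 (K : fieldType) (x : K) (a b c : int) :
  x != 0 -> a + b + c = 0 -> x ^ a * x ^ b * x ^ c = 1.
Proof. by move=> x0 abc; rewrite -!expfzDr // abc. Qed.

Section MutationTheory.
Variables (K : fieldType) (pos : K -> Prop) (vs : seq V).
Hypothesis sfK : semifield pos.
Implicit Types (s : seed K) (k u v : V).

Definition skew_seed s :=
  {in vs &, forall u v, seps s u v = - seps s v u}.

Definition pos_seed s := (forall u, pos (sx s u)) /\ (forall u, pos (sa s u)).

(** Seeds are total functions on [V], but skew-symmetry is only available on [vs], and involutivity
    of mutation depends on it; hence the comparison is restricted to [vs]. *)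
Definition seed_eqv s s' :=
  [/\ {in vs &, forall u v, seps s u v = seps s' u v},
      {in vs, sx s =1 sx s'} & {in vs, sa s =1 sa s'}].

Lemma seed_eqv_trans s1 s2 s3 :
  seed_eqv s1 s2 -> seed_eqv s2 s3 -> seed_eqv s1 s3.
Proof.
move=> [e1 x1 a1] [e2 x2 a2]; split=> [u v uV vV|u uV|u uV].
- by rewrite e1 ?e2.
- by rewrite x1 ?x2.
- by rewrite a1 ?a2.
Qed.

Lemma mutate_epsE k s u v : u != k -> v != k ->
  seps (mutate vs k s) u v = seps s u v +
    (ppart (seps s u k) * ppart (seps s k v)
     - ppart (- seps s u k) * ppart (- seps s k v)).
Proof. by move=> /negPf nu /negPf nv; rewrite /= nu nv exchange_termE. Qed.

Lemma mutate_eps_l k s v : seps (mutate vs k s) k v = - seps s k v.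
Proof. by rewrite /= eqxx. Qed.

Lemma mutate_eps_r k s u : seps (mutate vs k s) u k = - seps s u k.
Proof. by rewrite /= eqxx orbT. Qed.

(** The sign test disappears through [1 + x^-1 = (1 + x) / x], which releases a power of [x] exactly
    when the entry is positive. *)
Lemma mutate_xE k s u : sx s k != 0 -> u != k ->
  sx (mutate vs k s) u =
  sx s u * (sx s k ^ ppart (seps s u k) * (1 + sx s k) ^ (- seps s u k)).
Proof.
move=> xk /negPf nu; rewrite /= nu; congr (_ * _).
set x := sx s k in xk *; set e := seps s u k.
case: (ltrgt0P e) => he.
- rewrite gtr0_sgz // (_ : 1 + x ^ (- 1) = (1 + x) * x^-1); last first.
    by rewrite exprN1 mulrDl mulfV // mul1r addrC.
  by rewrite expfzMl exprz_inv opprK mulrC.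
- by rewrite ltr0_sgz // opprK expr1z expr0z mul1r.
- by rewrite he oppr0 !expr0z mul1r.
Qed.

Lemma mutate_x_self k s : sx (mutate vs k s) k = (sx s k)^-1.
Proof. by rewrite /= eqxx. Qed.

Lemma mutate_a_self k s :
  sa (mutate vs k s) k = (sa s k)^-1 *
    (\prod_(j <- vs) sa s j ^ ppart (seps s k j)
     + \prod_(j <- vs) sa s j ^ ppart (- seps s k j)).
Proof.
rewrite /= eqxx; congr (_ * (_ + _)).
- rewrite big_mkcond; apply: eq_bigr => j _.
  by case: (ltrgt0P (seps s k j)) => //; rewrite expr0z.
- rewrite big_mkcond; apply: eq_bigr => j _.
  case: ltP => h; first by congr (_ ^ _); lia.
  by rewrite (_ : ppart _ = 0) ?expr0z //; lia.
Qed.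

Lemma mutate_a_neq k s u : u != k -> sa (mutate vs k s) u = sa s u.
Proof. by move=> /negPf nu; rewrite /= nu. Qed.

Lemma mutate_skew k s : k \in vs -> skew_seed s -> skew_seed (mutate vs k s).
Proof.
move=> kV sk u v uV vV.
case: (eqVneq u k) => [->|nu]; first by rewrite mutate_eps_l mutate_eps_r sk.
case: (eqVneq v k) => [->|nv]; first by rewrite mutate_eps_l mutate_eps_r sk.
rewrite !mutate_epsE // (sk u v) // (sk u k) // (sk k v) //; lia.
Qed.

Lemma mutate_pos k s : pos_seed s -> pos_seed (mutate vs k s).
Proof.
move=> [px pa]; split=> u.
- case: (eqVneq u k) => [->|nu]; first by rewrite mutate_x_self; apply: pos_inv.
  rewrite mutate_xE ?(pos_neq0 sfK) //.
  apply: (pos_mul sfK) => //.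
  apply: (pos_mul sfK); apply: pos_exprz => //.
  by apply: (pos_add sfK) => //; case: sfK.
- case: (eqVneq u k) => [->|nu]; last by rewrite mutate_a_neq.
  rewrite mutate_a_self; apply: (pos_mul sfK); first exact: pos_inv.
  by apply: (pos_add sfK); apply: pos_prod => // j; apply: pos_exprz.
Qed.

Lemma mutate_eqv k s s' : k \in vs -> seed_eqv s s' ->
  seed_eqv (mutate vs k s) (mutate vs k s').
Proof.
move=> kV [Ee Ex Ea]; split=> [u v uV vV|u uV|u uV].
- by rewrite /= !Ee.
- by rewrite /= !Ee // !Ex.
- case: (eqVneq u k) => [->|nu]; last by rewrite !mutate_a_neq // Ea.
  rewrite !mutate_a_self Ea //; congr (_ * (_ + _));
    rewrite big_seq [in RHS]big_seq; apply: eq_bigr => j jV; by rewrite Ee ?Ea.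
Qed.

(** For X, the exponents [ppart e], [- ppart (- e)] and [- e] sum to zero. For A, negating the row
    only exchanges the two monomials of the binomial, which do not involve the variable at [k]
    because the diagonal entry vanishes; positivity allows the binomial to be cancelled. *)
Lemma mutateK k s : k \in vs -> skew_seed s -> pos_seed s ->
  seed_eqv (mutate vs k (mutate vs k s)) s.
Proof.
move=> kV sk ps; have [px pa] := ps; have [px' pa'] := mutate_pos k ps.
have nz := pos_neq0 sfK.
split=> [u v uV vV|u uV|u uV].
- case: (eqVneq u k) => [->|nu]; first by rewrite !mutate_eps_l opprK.
  case: (eqVneq v k) => [->|nv]; first by rewrite !mutate_eps_r opprK.
  rewrite mutate_epsE // mutate_epsE // mutate_eps_l mutate_eps_r; lia.
- case: (eqVneq u k) => [->|nu]; first by rewrite !mutate_x_self invrK.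
  rewrite mutate_xE ?nz // mutate_eps_r mutate_x_self mutate_xE ?nz //.
  set x := sx s k; set e := seps s u k.
  have x0 : x != 0 := nz _ (px k).
  have x10 : 1 + x != 0 := nz _ (pos_add sfK (pos_1 sfK) (px k)).
  have -> : 1 + x^-1 = (1 + x) * x^-1 by rewrite mulrDl mulfV // mul1r addrC.
  rewrite expfzMl !exprz_inv opprK -[RHS]mulr1 -!mulrA; congr (_ * _).
  rewrite !mulrA.
  have -> : x ^ ppart e * (1 + x) ^ (- e) * x ^ (- ppart (- e)) * (1 + x) ^ e * x ^ (- e) =
     (x ^ ppart e * x ^ (- ppart (- e)) * x ^ (- e)) * ((1 + x) ^ (- e) * (1 + x) ^ e) by ring.
  rewrite -[(1 + x) ^ (- e) * _]expfzDr // addNr expr0z !mulr1.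
  by apply: exprz_cancel3 => //; lia.
- case: (eqVneq u k) => [->|nu]; last by rewrite !mutate_a_neq.
  have ekk : seps s k k = 0 by have := sk _ _ kV kV; lia.
  rewrite mutate_a_self.
  have E1 : \prod_(j <- vs) sa (mutate vs k s) j ^ ppart (seps (mutate vs k s) k j)
      = \prod_(j <- vs) sa s j ^ ppart (- seps s k j).
    apply: eq_bigr => j _; rewrite mutate_eps_l.
    by case: (eqVneq j k) => [->|nj]; [rewrite ekk oppr0 !expr0z|rewrite mutate_a_neq].
  have E2 : \prod_(j <- vs) sa (mutate vs k s) j ^ ppart (- seps (mutate vs k s) k j)
      = \prod_(j <- vs) sa s j ^ ppart (seps s k j).
    apply: eq_bigr => j _; rewrite mutate_eps_l opprK.
    by case: (eqVneq j k) => [->|nj]; [rewrite ekk !expr0z|rewrite mutate_a_neq].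
  rewrite E1 E2 mutate_a_self addrC invfM invrK mulfVK //.
  by apply/nz/(pos_add sfK); apply: pos_prod => // j; apply: pos_exprz.
Qed.

Lemma mutseq_skew ws s : {subset ws <= vs} -> skew_seed s -> skew_seed (mutseq vs ws s).
Proof.
elim: ws s => [|w ws IH] s //= sub sk; apply: IH => [u uw|].
  by apply: sub; rewrite inE uw orbT.
by apply: mutate_skew => //; apply: sub; rewrite mem_head.
Qed.

Lemma mutseq_pos ws s : pos_seed s -> pos_seed (mutseq vs ws s).
Proof. by elim: ws s => [|w ws IH] s //= ps; apply/IH/mutate_pos. Qed.

Lemma mutseq_eqv ws s s' : {subset ws <= vs} -> seed_eqv s s' ->
  seed_eqv (mutseq vs ws s) (mutseq vs ws s').
Proof.
elim: ws s s' => [|w ws IH] s s' //= sub sE; apply: IH => [u uw|].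
  by apply: sub; rewrite inE uw orbT.
by apply: mutate_eqv => //; apply: sub; rewrite mem_head.
Qed.

Lemma mutseqK ws s : {subset ws <= vs} -> skew_seed s -> pos_seed s ->
  seed_eqv (mutseq vs (rev ws) (mutseq vs ws s)) s.
Proof.
elim: ws s => [|w ws IH] s //= sub sk ps.
have wV : w \in vs by apply: sub; rewrite mem_head.
have sub' : {subset ws <= vs} by move=> u uw; apply: sub; rewrite inE uw orbT.
rewrite rev_cons -cats1 /mutseq foldl_cat -/(mutseq _ _ _) -/(mutseq _ _ _) /=.
apply: seed_eqv_trans (mutateK wV sk ps).
apply: mutate_eqv => //; apply: IH => //; [exact: mutate_skew|exact: mutate_pos].
Qed.

End MutationTheory.

(** * Exchanging two opposite vertices *)

Section SwapMutation.
Variables (K : fieldType) (pos : K -> Prop) (vs : seq V).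
Hypothesis sfK : semifield pos.
Variables (s : seed K) (a b : V).
Hypotheses (skew_s : skew_seed vs s) (pos_s : pos_seed pos s).
Hypotheses (aV : a \in vs) (bV : b \in vs) (ab : a != b).
Hypothesis opp_ab : {in vs, forall u, seps s u b = - seps s u a}.

Let s' := swap_seed a b (mutate vs b (mutate vs a s)).

Let eaa : seps s a a = 0.
Proof. by have := skew_s aV aV; lia. Qed.

Let eab : seps s a b = 0.
Proof. by rewrite opp_ab // eaa oppr0. Qed.

Let eba : seps s b a = 0.
Proof. by rewrite skew_s // eab oppr0. Qed.

Let ebb : seps s b b = 0.
Proof. by rewrite opp_ab // eba oppr0. Qed.

Let row_ab u : u \in vs -> seps s b u = - seps s a u.
Proof. by move=> uV; rewrite skew_s // opp_ab // opprK skew_s // opprK. Qed.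

Let swap_a : swapv a b a = b. Proof. by rewrite /swapv eqxx. Qed.
Let swap_b : swapv a b b = a.
Proof. by rewrite /swapv eq_sym (negPf ab) eqxx. Qed.
Let swap_id u : u != a -> u != b -> swapv a b u = u.
Proof. by rewrite /swapv => /negPf -> /negPf ->. Qed.

Let ba : b != a. Proof. by rewrite eq_sym. Qed.

Let mut_bv v : v \in vs -> seps (mutate vs a s) b v = seps s b v.
Proof.
move=> vV; case: (eqVneq v a) => [->|va]; first by rewrite mutate_eps_r eba.
by rewrite mutate_epsE // eba; lia.
Qed.

Let mut_vb v : v \in vs -> seps (mutate vs a s) v b = seps s v b.
Proof.
move=> vV; case: (eqVneq v a) => [->|va]; first by rewrite mutate_eps_l eab.
by rewrite mutate_epsE // eab; lia.
Qed.

(** Opposite columns force [a] and [b] to be disconnected. Between other vertices, the paths created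
    through [a] are cancelled by those through [b], whose signs are all reversed; the rows of [a]
    and [b] are negated, hence interchanged, and the exchange of labels undoes this. *)
Lemma swap_mutate_eps : {in vs &, forall u v, seps s' u v = seps s u v}.
Proof.
move=> u v uV vV; rewrite /s' /=.
change (seps (mutate vs b (mutate vs a s)) (swapv a b u) (swapv a b v) = seps s u v).
have sV x : x \in vs -> swapv a b x \in vs by rewrite /swapv; case: ifP => // _; case: ifP.
case: (eqVneq u a) => [->|ua].
  rewrite swap_a mutate_eps_l mut_bv ?sV //.
  case: (eqVneq v a) => [->|va]; first by rewrite swap_a ebb eaa.
  case: (eqVneq v b) => [->|vb]; first by rewrite swap_b eba eab.
  by rewrite swap_id // row_ab // opprK.
case: (eqVneq v a) => [->|va].
  rewrite swap_a mutate_eps_r mut_vb ?sV //.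
  case: (eqVneq u b) => [->|ub]; first by rewrite swap_b eab eba.
  by rewrite swap_id // opp_ab // opprK.
case: (eqVneq u b) => [->|ub].
  rewrite swap_b mutate_epsE ?sV //; last by rewrite /swapv (negPf va); case: (eqVneq v b).
  rewrite mut_vb // eab mutate_eps_l.
  case: (eqVneq v b) => [->|vb]; first by rewrite swap_b eaa ebb; lia.
  by rewrite swap_id // row_ab //; lia.
case: (eqVneq v b) => [->|vb].
  rewrite swap_b swap_id // mutate_epsE // mutate_eps_r mut_bv // eba mut_vb // opp_ab //; lia.
by rewrite !swap_id // mutate_epsE // mutate_epsE // mut_bv // mut_vb // row_ab // opp_ab //; lia.
Qed.

Lemma swap_mutate_x_l : sx s' a = (sx s b)^-1.
Proof.
rewrite /s' /swap_seed.
change (sx (mutate vs b (mutate vs a s)) (swapv a b a) = (sx s b)^-1).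
rewrite swap_a mutate_x_self mutate_xE ?eba //; last by apply: (pos_neq0 sfK); case: pos_s.
by rewrite oppr0 !expr0z !mulr1.
Qed.

Let pos_ma := mutate_pos vs sfK a pos_s.

Lemma swap_mutate_x_r : sx s' b = (sx s a)^-1.
Proof.
change (sx (mutate vs b (mutate vs a s)) (swapv a b b) = (sx s a)^-1).
rewrite swap_b mutate_xE //; last by apply: (pos_neq0 sfK); case: pos_ma.
by rewrite mut_vb // eab oppr0 !expr0z !mulr1 mutate_x_self.
Qed.

Lemma swap_mutate_x u : u \in vs -> u != a -> u != b ->
  sx s' u = sx s u
    * (sx s a ^ ppart (seps s u a) * (1 + sx s a) ^ (- seps s u a))
    * (sx s b ^ ppart (- seps s u a) * (1 + sx s b) ^ (seps s u a)).
Proof.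
move=> uV ua ub.
change (sx (mutate vs b (mutate vs a s)) (swapv a b u) = sx s u
    * (sx s a ^ ppart (seps s u a) * (1 + sx s a) ^ (- seps s u a))
    * (sx s b ^ ppart (- seps s u a) * (1 + sx s b) ^ (seps s u a))).
have xa0 : sx s a != 0 by apply: (pos_neq0 sfK); case: pos_s.
have -> : swapv a b u = u by apply: swap_id.
rewrite mutate_xE //; last by apply: (pos_neq0 sfK); case: pos_ma.
have -> : sx (mutate vs a s) b = sx s b by rewrite mutate_xE // eba oppr0 !expr0z !mulr1.
by rewrite mut_vb // opp_ab // opprK mutate_xE.
Qed.

(** Since the rows of [a] and [b] are opposite, the exchange binomials at the two vertices have the
    same two monomials in opposite order: this single [E] serves both. *)
Let E := \prod_(j <- vs) sa s j ^ ppart (seps s a j)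
         + \prod_(j <- vs) sa s j ^ ppart (- seps s a j).

Lemma swap_mutate_a_r : sa s' b = (sa s a)^-1 * E.
Proof.
change (sa (mutate vs b (mutate vs a s)) (swapv a b b) = (sa s a)^-1 * E).
by rewrite swap_b mutate_a_neq // mutate_a_self.
Qed.

Lemma swap_mutate_a_l : sa s' a = (sa s b)^-1 * E.
Proof.
change (sa (mutate vs b (mutate vs a s)) (swapv a b a) = (sa s b)^-1 * E).
rewrite swap_a mutate_a_self mutate_a_neq //; congr (_ * _); rewrite addrC /E.
congr (_ + _); rewrite big_seq [in RHS]big_seq; apply: eq_bigr => j jV;
  rewrite mut_bv // row_ab // ?opprK.
- by case: (eqVneq j a) => [->|ja]; [rewrite eaa !expr0z|rewrite mutate_a_neq].
- by case: (eqVneq j a) => [->|ja]; [rewrite eaa !expr0z|rewrite mutate_a_neq].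
Qed.

Lemma swap_mutate_a u : u != a -> u != b -> sa s' u = sa s u.
Proof.
move=> ua ub.
change (sa (mutate vs b (mutate vs a s)) (swapv a b u) = sa s u).
by rewrite swap_id // !mutate_a_neq.
Qed.

End SwapMutation.

Lemma prod_exprz_add (K : fieldType) (I : Type) (r : seq I) (P : pred I)
    (F : I -> K) (a b : I -> int) : (forall i, F i != 0) ->
  (\prod_(i <- r | P i) F i ^ a i) * (\prod_(i <- r | P i) F i ^ b i)
  = \prod_(i <- r | P i) F i ^ (a i + b i).
Proof.
by move=> F0; rewrite -big_split; apply: eq_bigr => i _; rewrite expfzDr.
Qed.

Lemma prod_exprz_delta (K : fieldType) (I : eqType) (r : seq I) (F : I -> K) c :
  uniq r -> c \in r -> \prod_(i <- r) F i ^ ((i == c)%:Z) = F c.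
Proof.
move=> ur cr; rewrite (bigD1_seq c) //= eqxx expr1z big1 ?mulr1 // => i /negPf ->.
by rewrite expr0z.
Qed.

(** * Mutation along a balanced cycle *)

Definition cycle_seq (w : int -> V) (n : nat) : seq V :=
  [seq w (Posz c) | c <- iota 1 n].

(** [w] is indexed by all integers so that indices below 1 make sense, whereas [S u] is only read on
    0, ..., p-1, with [S u 0] standing for its value at p. Writing [bc_cycle] as a sum of indicators
    covers p = 2, where the two opposite arrows cancel. The last two fields fix the additive
    constant of [S u]: its minimum is 0. *)
Record balanced_cycle (vs : seq V) (e : V -> V -> int) (p : nat)
    (w : int -> V) (S : V -> nat -> int) : Prop := BalancedCycle {
  bc_size : (1 < p)%N;
  bc_uniq : uniq vs;
  bc_mem : forall z, w z \in vs;
  bc_per : forall z, w (z + Posz p) = w z;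
  bc_inj : forall i j : nat, (0 < i <= p)%N -> (0 < j <= p)%N ->
    w (Posz i) = w (Posz j) -> i = j;
  bc_skew : {in vs &, forall u v, e u v = - e v u};
  bc_cycle : forall i j : nat, (0 < i <= p)%N -> (0 < j <= p)%N ->
    e (w (Posz i)) (w (Posz j)) = (j == i.+1)%:Z - (i == j.+1)%:Z
      + ((i == p) && (j == 1%N))%:Z - ((i == 1%N) && (j == p))%:Z;
  bc_out : forall u, u \in vs -> u \notin cycle_seq w p ->
    forall j : nat, (0 < j <= p)%N ->
    e u (w (Posz j)) = (if j == p then S u 0%N else S u j) - S u j.-1;
  bc_ge0 : forall u, u \in vs -> u \notin cycle_seq w p ->
    forall j, (j < p)%N -> 0 <= S u j;
  bc_zero : forall u, u \in vs -> u \notin cycle_seq w p ->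
    exists2 j, (j < p)%N & S u j = 0 }.

Fixpoint runmin (S : nat -> int) (n : nat) : int :=
  if n is n'.+1 then Num.min (runmin S n') (S n) else S 0%N.

(** Horner form of 1 + X_n + X_n X_(n-1) + ... + X_n ... X_1, the version of f_X that stops at index
    1 instead of wrapping around the cycle. *)
Fixpoint chainF (K : fieldType) (X : nat -> K) (n : nat) : K :=
  if n is n'.+1 then 1 + X n * chainF X n' else 1.

Lemma bool_exchange (a b c d : bool) : ~~ (a && b) -> ~~ (c && d) ->
  ppart (a%:Z - b%:Z) * ppart (c%:Z - d%:Z)
  - ppart (- (a%:Z - b%:Z)) * ppart (- (c%:Z - d%:Z))
  = (a && c)%:Z - (b && d)%:Z.
Proof. by case: a b c d => [] [] [] []. Qed.

Lemma exchange_bool (c : int) (a b : bool) : ~~ (a && b) ->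
  ppart c * ppart (a%:Z - b%:Z) - ppart (- c) * ppart (- (a%:Z - b%:Z))
  = (if a then ppart c else 0) - (if b then ppart (- c) else 0).
Proof.
have p1 : ppart (1%:Z - 0%:Z) = 1 by [].
have n1 : ppart (- (1%:Z - 0%:Z)) = 0 by [].
have p2 : ppart (0%:Z - 1%:Z) = 0 by [].
have n2 : ppart (- (0%:Z - 1%:Z)) = 1 by [].
have p3 : ppart (0%:Z - 0%:Z) = 0 by [].
have n3 : ppart (- (0%:Z - 0%:Z)) = 0 by [].
case: a b => [] [] //= _.
- by rewrite p1 n1 mulr1 mulr0.
- by rewrite p2 n2 mulr1 mulr0.
- by rewrite p3 ?n3 !mulr0.
Qed.

Lemma prodS (K : fieldType) (X : nat -> K) n :
  \prod_(1 <= i < n.+2) X i = \prod_(1 <= i < n.+1) X i * X n.+1.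
Proof. by rewrite big_nat_recr. Qed.

Section CycleMutation.
Variables (K : fieldType) (pos : K -> Prop) (vs : seq V).
Hypothesis sfK : semifield pos.
Variables (p : nat) (w : int -> V) (S : V -> nat -> int) (s : seed K).
Hypothesis bc : balanced_cycle vs (seps s) p w S.
Hypothesis pos_s : pos_seed pos s.

Local Notation P := (cycle_seq w p).
Local Notation wn n := (w (Posz n)).
Local Notation mm := (fun u => runmin (S u)).
Let st n := mutseq vs (cycle_seq w n) s.

Let p_gt1 := bc_size bc.

Lemma cycle_seqS n : cycle_seq w n.+1 = rcons (cycle_seq w n) (wn n.+1).
Proof. by rewrite /cycle_seq -[X in iota 1 X]addn1 iotaD map_cat cats1. Qed.

Lemma mutseq_cycleS n : st n.+1 = mutate vs (wn n.+1) (st n).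
Proof. by rewrite /st cycle_seqS -cats1 /mutseq foldl_cat. Qed.

Lemma cycle_seq_sub n : {subset cycle_seq w n <= vs}.
Proof. by move=> u /mapP[c _ ->]; apply: bc_mem bc _. Qed.

Lemma st_skew n : skew_seed vs (st n).
Proof. exact: mutseq_skew (@cycle_seq_sub n) (bc_skew bc). Qed.

Lemma st_pos n : pos_seed pos (st n).
Proof. exact: mutseq_pos. Qed.

Lemma w_mem z : w z \in vs. Proof. exact: bc_mem bc z. Qed.

Lemma w_neq i j : (0 < i <= p)%N -> (0 < j <= p)%N -> i != j -> wn i != wn j.
Proof. by move=> hi hj; apply: contraNneq => /(bc_inj bc hi hj) ->. Qed.

Lemma w_inP j : (0 < j <= p)%N -> wn j \in P.
Proof. by move=> hj; apply/mapP; exists j => //; rewrite mem_iota; lia. Qed.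

Lemma out_neq u j : u \notin P -> (0 < j <= p)%N -> u != wn j.
Proof. by move=> uP hj; apply: contraNneq uP => ->; apply: w_inP. Qed.

(** * The quiver along the mutations of [M(P)] *)

Lemma st_eps_in n i j : (n.+2 <= p)%N -> (n < i <= p)%N -> (n < j <= p)%N ->
  seps (st n) (wn i) (wn j) = (j == i.+1)%:Z - (i == j.+1)%:Z
      + ((i == p) && (j == n.+1))%:Z - ((i == n.+1) && (j == p))%:Z.
Proof.
elim: n i j => [|n IH] i j np hi hj; first by rewrite (bc_cycle bc).
have [hn hi' hj' hk] : [/\ n.+2 <= p, n < i <= p, n < j <= p & n < n.+1 <= p]%N by split; lia.
have [ik jk] : wn i != wn n.+1 /\ wn j != wn n.+1 by split; apply: w_neq; lia.
(* Inside the remaining cycle the only path through w_(n+1) is w_p -> w_(n+1) -> w_(n+2); the arrow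
   it creates closes the shorter cycle. *)
rewrite mutseq_cycleS mutate_epsE // !IH //.
rewrite (_ : (n.+1 == i.+1)%:Z - _ + _ - _ = (i == p)%:Z - (i == n.+2)%:Z); last lia.
rewrite (_ : (j == n.+2)%:Z - _ + _ - _ = (j == n.+2)%:Z - (j == p)%:Z); last lia.
rewrite bool_exchange; lia.
Qed.

Lemma st_eps_row n j : (n.+2 <= p)%N -> (n < j <= p)%N ->
  seps (st n) (wn n.+1) (wn j) = (j == n.+2)%:Z - (j == p)%:Z.
Proof. by move=> np hj; rewrite st_eps_in //; lia. Qed.

Lemma st_eps_col n i : (n.+2 <= p)%N -> (n < i <= p)%N ->
  seps (st n) (wn i) (wn n.+1) = (i == p)%:Z - (i == n.+2)%:Z.
Proof. by move=> np hj; rewrite st_eps_in //; lia. Qed.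

(** Only the vertex mutated last still meets the remaining cycle. The next mutation detaches it: the
    path w_p -> w_(n+1) -> w_n cancels the arrow w_n -> w_p. *)
Lemma st_eps_past n i j : (n.+2 <= p)%N -> (0 < i <= n)%N -> (n < j <= p)%N ->
  seps (st n) (wn i) (wn j) =
  if i == n then (j == p)%:Z - (j == n.+1)%:Z else 0.
Proof.
elim: n i j => [|n IH] i j np hi hj; first lia.
have [hn hj' hk] : [/\ n.+2 <= p, n < j <= p & n < n.+1 <= p]%N by split; lia.
rewrite mutseq_cycleS; case: (eqVneq i n.+1) => [->|ni].
  by rewrite mutate_eps_l st_eps_row // opprB.
have [ik jk] : wn i != wn n.+1 /\ wn j != wn n.+1 by split; apply: w_neq; lia.
have hi' : (0 < i <= n)%N by lia.
rewrite mutate_epsE // st_eps_row // exchange_bool ?IH //; last lia.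
rewrite eqxx (_ : (j == n.+1) = false) 1?(_ : (n.+1 == p) = false); try lia.
case: (i == n); case: (eqVneq j p); case: (eqVneq j n.+2) => /=; lia.
Qed.

(** Let c = S_u(n+1) - m_n be the entry met at w_(n+1). If c > 0, paths through it to w_(n+2)
    replace S_u(n+1) by m_n there; if c < 0, paths from w_p replace m_n by S_u(n+1) at w_p. The two
    signs are the two branches of the minimum. *)
Lemma st_eps_out u n j : u \in vs -> u \notin P ->
  (n.+2 <= p)%N -> (n < j <= p)%N ->
  seps (st n) u (wn j) = (if j == p then mm u n else S u j)
                         - (if j == n.+1 then mm u n else S u j.-1).
Proof.
move=> uV uP; elim: n j => [|n IH] j np hj.
  by rewrite (bc_out bc) //=; case: (eqVneq j 1%N) => [->|].

have [hn hj' hk] : [/\ n.+2 <= p, n < j <= p & n < n.+1 <= p]%N by split; lia.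
have [uk jk] : u != wn n.+1 /\ wn j != wn n.+1.
  by split; [apply: out_neq => //|apply: w_neq]; lia.
rewrite mutseq_cycleS mutate_epsE // st_eps_row // exchange_bool ?IH //=; last lia.
rewrite eqxx (_ : (j == n.+1) = false) 1?(_ : (n.+1 == p) = false); try lia.
case: (eqVneq j n.+2) => [->|j2] /=; case: (eqVneq _ p) => // [e|e]; lia.
Qed.

Local Notation c u j := (S u j - mm u j.-1).

Lemma st_eps_out_next u n : u \in vs -> u \notin P -> (n.+2 <= p)%N ->
  seps (st n) u (wn n.+1) = c u n.+1.
Proof.
move=> uV uP np; rewrite st_eps_out // ?eqxx; last lia.
by rewrite (_ : (n.+1 == p) = false) //; lia.
Qed.

(** * The X-variables along [M(P)] *)

Let X j := sx s (wn j).
Let F := chainF X.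

Let FS n : F n.+1 = 1 + X n.+1 * F n. Proof. by []. Qed.

Let X_pos j : pos (X j). Proof. exact: (proj1 pos_s). Qed.

Let F_pos n : pos (F n).
Proof.
elim: n => [|n IH]; first exact: pos_1.
by apply: (pos_add sfK); [exact: pos_1|apply: (pos_mul sfK) => //; exact: X_pos].
Qed.

Let X_neq0 j : X j != 0. Proof. exact: (pos_neq0 sfK) (X_pos j). Qed.
Let F_neq0 j : F j != 0. Proof. exact: (pos_neq0 sfK) (F_pos j). Qed.
Let stx_neq0 n u : sx (st n) u != 0.
Proof. exact: (pos_neq0 sfK) (proj1 (st_pos n) u). Qed.

Lemma st_x_next n j : (n.+2 <= p)%N -> (n < j < p)%N ->
  sx (st n) (wn j) = X j * (if j == n.+1 then F n else 1).
Proof.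
elim: n j => [|n IH] j np hj.
  by rewrite /st /=; case: ifP => _; rewrite mulr1.
have [hn hj' hj2] : [/\ n.+2 <= p, n < j < p & n < j <= p]%N by split; lia.
have hk : (n < n.+1 < p)%N by lia.
have jk : wn j != wn n.+1 by apply: w_neq; lia.
rewrite mutseq_cycleS mutate_xE // st_eps_col // (IH j) // (IH n.+1) // eqxx.
rewrite (_ : (j == p) = false) 1?(_ : (j == n.+1) = false); try lia.
by case: eqP => _; rewrite /= ?mulr1 ?mul1r ?expr1z.
Qed.

Lemma st_x_succ n : (n.+2 <= p)%N -> sx (st n) (wn n.+1) = X n.+1 * F n.
Proof. by move=> np; rewrite st_x_next ?eqxx //; lia. Qed.

(** Each mutation multiplies this variable by x / (1 + x) = X_(n+1) F_n / F_(n+1), so the factors F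
    telescope. *)
Lemma st_x_last n : (n.+2 <= p)%N ->
  sx (st n) (wn p) = X p * (\prod_(1 <= i < n.+1) X i) / F n.
Proof.
elim: n => [|n IH] np; first by rewrite big_nil mulr1 divr1.
have hn : (n.+2 <= p)%N by lia.
have pk : wn p != wn n.+1 by apply: w_neq; lia.
rewrite mutseq_cycleS mutate_xE // st_eps_col //; last lia.
rewrite eqxx (_ : (p == n.+2) = false); last lia.
rewrite subr0 expr1z exprN1 IH // st_x_succ // prodS -FS.
by field; rewrite !F_neq0.
Qed.

(** After its inversion, w_j is affected by the next mutation only, which contributes 1 + X_(j+1)
    F_j = F_(j+1). *)
Lemma st_x_past n j : (n.+2 <= p)%N -> (0 < j <= n)%N ->
  sx (st n) (wn j) = (X j * F j.-1)^-1 * (if (j < n)%N then F j.+1 else 1).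
Proof.
elim: n j => [|n IH] j np hj; first lia.
have hn : (n.+2 <= p)%N by lia.
rewrite mutseq_cycleS; case: (eqVneq j n.+1) => [->|nj].
  by rewrite mutate_x_self st_x_succ // ltnn mulr1.
have jk : wn j != wn n.+1 by apply: w_neq; lia.
have hj' : (0 < j <= n)%N by lia.
rewrite mutate_xE // st_eps_past //; last lia.
rewrite IH // st_x_succ // -FS eqxx (_ : (n.+1 == p) = false); last lia.
rewrite (_ : (j < n.+1)%N); last lia.
by case: (eqVneq j n) => [->|jn];
  [rewrite ltnn|rewrite (_ : (j < n)%N); last lia]; rewrite /= ?oppr0 ?expr0z ?mulr1 ?mul1r.
Qed.

Lemma st_x_out n u : (n.+2 <= p)%N -> u \in vs -> u \notin P ->
  sx (st n) u = sx s u * \prod_(1 <= j < n.+1)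
    ((X j * F j.-1) ^ ppart (c u j) * F j ^ (- c u j)).
Proof.
move=> np uV uP; elim: n np => [|n IH] np; first by rewrite big_nil mulr1.
have hn : (n.+2 <= p)%N by lia.
have uk : u != wn n.+1 by apply: out_neq => //; lia.
rewrite mutseq_cycleS mutate_xE // st_eps_out_next // IH // st_x_succ //.
by rewrite prodS mulrA -FS.
Qed.

Lemma runmin_le (f : nat -> int) n j : (j <= n)%N -> runmin f n <= f j.
Proof.
elim: n => [|n IH]; first by rewrite leqn0 => /eqP ->.
rewrite leq_eqVlt => /orP[/eqP ->|/IH] /=; lia.
Qed.

(** The normalisation of [S] is used here: with minimum 0, no monomial in the outer A-variables
    survives once the whole cycle has been scanned. *)
Lemma runmin_last u : u \in vs -> u \notin P -> mm u p.-1 = 0.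
Proof.
move=> uV uP; have [j jp Sj] := bc_zero bc uV uP.
have ge0 n : (n < p)%N -> 0 <= runmin (S u) n.
  elim: n => [|n IH] np; first exact: bc_ge0 bc _ uV uP _ np.
  by have /= := bc_ge0 bc uV uP np; have := IH (ltnW np); lia.
have := @runmin_le (S u) p.-1 j; have := ge0 p.-1.
rewrite Sj; lia.
Qed.

Lemma prod_split_cycle (G : V -> K) :
  \prod_(j <- vs) G j =
  (\prod_(j <- vs | j \notin P) G j) * \prod_(1 <= i < p.+1) G (wn i).
Proof.
rewrite (bigID (fun u => u \in P)) /= mulrC; congr (_ * _).
rewrite -big_filter (perm_big P) /=; first by rewrite /cycle_seq big_map /index_iota subn1.
apply: uniq_perm; first exact/filter_uniq/(bc_uniq bc).
  rewrite map_inj_in_uniq ?iota_uniq // => i j; rewrite !mem_iota => hi hj.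
  by apply: (bc_inj bc); lia.
move=> u; rewrite mem_filter; case uP: (u \in P) => //=.
exact: cycle_seq_sub uP.
Qed.

(** * The A-variables along [M(P)] *)

Let A j := sa s (wn j).
Let outp (x : V -> int) := \prod_(u <- vs | u \notin P) sa s u ^ x u.
Let Q i := (A i * A i.+1)^-1 * outp (fun u => S u i).
(** The value at w_j after its mutation, for 0 < j <= p-2; the sum is a partial sum of f_A. As A_0 =
    A_p, it equals 1 at j = 0, so the first exchange relation, which has no preceding vertex, takes
    the same form as the others. *)
Let D j := A j.+1 * A p * outp (fun u => - mm u j) * \sum_(i < j.+1) Q i.

Let sa_neq0 u : sa s u != 0.
Proof. exact: (pos_neq0 sfK) (proj2 pos_s u). Qed.
Let A_neq0 j : A j != 0. Proof. exact: sa_neq0. Qed.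

Let outp_pos x : pos (outp x).
Proof. by apply: (pos_prod sfK) => u; apply: (pos_exprz sfK); case: pos_s. Qed.
Let A0 : A 0 = A p.
Proof. by rewrite /A -(bc_per bc) add0r. Qed.

Let outpD x y z : (forall u, x u + y u = z u) -> outp x * outp y = outp z.
Proof.
by move=> E; rewrite /outp prod_exprz_add //; apply: eq_bigr => u _; rewrite E.
Qed.

Let D0 : D 0 = 1.
Proof.
rewrite /D big_ord_recl big_ord0 addr0 /Q A0.
have E : outp (fun u => - mm u 0%N) * outp (fun u => S u 0%N) = 1.
  rewrite (@outpD _ _ (fun=> 0)) => [|u /=]; last by rewrite addNr.
  by apply: big1 => u _; rewrite expr0z.
rewrite invfM -[RHS]E /=; field.
by rewrite !A_neq0.
Qed.

Let R1 n := outp (fun u => ppart (- c u n)).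
Let R2 n := outp (fun u => ppart (c u n)).

(** This is the exchange relation at w_(n+1). With c = S_u(n+1) - m_n, the positive part of -c is
    the drop m_n - m_(n+1) of the running minimum, and that of c is S_u(n+1) - m_(n+1): the first
    product updates the monomial, the second supplies the new summand [Q]. *)
Let D_rec n : A n.+1 * D n.+1 = A n.+2 * D n * R1 n.+1 + A p * R2 n.+1.
Proof.
have E1 : outp (fun u => - mm u n.+1) = outp (fun u => - mm u n) * R1 n.+1.
  by symmetry; apply: outpD => u /=; lia.
have E2 : R2 n.+1 = outp (fun u => - mm u n.+1) * outp (fun u => S u n.+1).
  by symmetry; apply: outpD => u /=; lia.
have E3 : \sum_(i < n.+2) Q i = \sum_(i < n.+1) Q i + Q n.+1 by rewrite big_ord_recr.
have E4 : Q n.+1 = (A n.+1 * A n.+2)^-1 * outp (fun u => S u n.+1) by [].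
rewrite E2 /D !E1 E3 E4; set sg := \sum_(i < n.+1) _.
by field; rewrite !A_neq0.
Qed.

Lemma st_eps_full_row n i : (n.+2 <= p)%N -> (0 < i <= p)%N ->
  seps (st n) (wn n.+1) (wn i) = (i == n.+2)%:Z + (i == n)%:Z - (i == p)%:Z.
Proof.
move=> np hi; case: (ltnP n i) => ni; first by rewrite st_eps_row; lia.
rewrite (st_skew n) ?w_mem // st_eps_past //; try lia.
by case: (i == n) / eqP; lia.
Qed.

Lemma st_a_out n u : u \notin P -> (n <= p)%N -> sa (st n) u = sa s u.
Proof.
move=> uP; elim: n => [|n IH] np //.
by rewrite mutseq_cycleS mutate_a_neq ?IH //; [lia|apply: out_neq => //; lia].
Qed.

Lemma st_a_next n j : (n < j <= p)%N -> sa (st n) (wn j) = A j.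
Proof.
elim: n => [|n IH] np //.
by rewrite mutseq_cycleS mutate_a_neq ?IH //; [lia|apply: w_neq; lia].
Qed.

Let stc_neq0 n i : sa (st n) (wn i) != 0.
Proof. exact: (pos_neq0 sfK) (proj2 (st_pos n) _). Qed.

Let prod_delta_cycle n i : (0 < i <= p)%N ->
  \prod_(1 <= j < p.+1) sa (st n) (wn j) ^ ((j == i)%:Z) = sa (st n) (wn i).
Proof.
move=> hi; apply: (@prod_exprz_delta _ _ _ (fun j => sa (st n) (wn j))).
  exact: iota_uniq.
by rewrite mem_index_iota; lia.
Qed.

(** When n + 2 = p, the arrows between w_(p-1) and w_p have cancelled, so neither monomial contains
    A_p; the conditionals record this. *)
Let st_a_prods n : (n.+2 <= p)%N ->
  (0 < n -> sa (st n) (wn n) = D n)%N ->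
  \prod_(j <- vs) sa (st n) j ^ ppart (seps (st n) (wn n.+1) j)
    = R1 n.+1 * (D n * (if n.+2 == p then 1 else A n.+2)) /\
  \prod_(j <- vs) sa (st n) j ^ ppart (- seps (st n) (wn n.+1) j)
    = R2 n.+1 * (if n.+2 == p then 1 else A p).
Proof.
move=> np an; rewrite !prod_split_cycle.
have Dn : \prod_(1 <= i < p.+1) sa (st n) (wn i) ^ ((i == n)%:Z) = D n.
  case: (posnP n) => [n0|n0]; last by rewrite prod_delta_cycle ?an //; lia.
  have -> : D n = 1 by rewrite n0 D0.
  rewrite big_nat big1 // => i hi.
  by rewrite (_ : (i == n) = false) //; lia.
split; congr (_ * _).
- rewrite /R1 /outp big_seq_cond [in RHS]big_seq_cond.
  apply: eq_bigr => u /andP[uV uP]; rewrite st_a_out //; last lia.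
  by rewrite (st_skew n) ?w_mem // st_eps_out_next.
- case: eqP => np'.
    rewrite mulr1 -Dn big_nat [in RHS]big_nat; apply: eq_bigr => i hi.
    by rewrite st_eps_full_row //; congr (_ ^ _); lia.
  rewrite -[A _](@st_a_next n); last lia.
  rewrite -prod_delta_cycle; last lia.
  rewrite -Dn prod_exprz_add // big_nat [in RHS]big_nat; apply: eq_bigr => i hi.
  by rewrite st_eps_full_row //; congr (_ ^ _); lia.
- rewrite /R2 /outp big_seq_cond [in RHS]big_seq_cond.
  apply: eq_bigr => u /andP[uV uP]; rewrite st_a_out //; last lia.
  by rewrite (st_skew n) ?w_mem // st_eps_out_next // opprK.
- case: eqP => np'.
    rewrite big_nat big1 // => i hi.
    by rewrite st_eps_full_row // (_ : ppart _ = 0) ?expr0z //; lia.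
  rewrite -[A _](@st_a_next n); last lia.
  rewrite -prod_delta_cycle; last lia.
  rewrite big_nat [in RHS]big_nat; apply: eq_bigr => i hi.
  by rewrite st_eps_full_row //; congr (_ ^ _); lia.
Qed.

Lemma st_a_past n j : (n.+2 <= p)%N -> (0 < j <= n)%N -> sa (st n) (wn j) = D j.
Proof.
elim: n j => [|n IH] j np hj; first lia.
have hn : (n.+2 <= p)%N by lia.
rewrite mutseq_cycleS; case: (eqVneq j n.+1) => [->|nj]; last first.
  by rewrite mutate_a_neq ?IH //; [lia|apply: w_neq; lia].
have an : (0 < n -> sa (st n) (wn n) = D n)%N by move=> n0; apply: IH => //; lia.
have [E1 E2] := st_a_prods hn an.
rewrite mutate_a_self E1 E2 st_a_next; last lia.
rewrite (_ : (n.+2 == p) = false); last lia.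
by apply: (mulfI (A_neq0 n.+1)); rewrite mulrA mulfV // mul1r D_rec; ring.
Qed.

(** The binomial is the right side of [D_rec] at n = p-2 divided by the common factor A_p. On the
    left side [runmin_last] removes the outer monomial and the sum has become complete. *)
Lemma st_a_swap :
  \prod_(j <- vs) sa (st (p - 2)) j ^ ppart (seps (st (p - 2)) (wn (p - 1)) j)
  + \prod_(j <- vs) sa (st (p - 2)) j ^ ppart (- seps (st (p - 2)) (wn (p - 1)) j)
  = A (p - 1) * A p * \sum_(i < p) Q i.
Proof.
have [n pn] : exists n, p = n.+2 by exists (p - 2)%N; lia.
have -> : (p - 2)%N = n by lia.
have -> : (p - 1)%N = n.+1 by lia.
have hn : (n.+2 <= p)%N by rewrite pn.
have [||E1 E2] := @st_a_prods n => //.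
  by move=> n0; apply: st_a_past => //; lia.
have Dn1 : D n.+1 = A p * A p * \sum_(i < p) Q i.
  rewrite /D -pn (_ : outp _ = 1) ?mulr1 //.
  rewrite /outp big_seq_cond big1 // => u /andP[uV uP].
  by have := runmin_last uV uP; rewrite pn /= => ->; rewrite oppr0 expr0z.
rewrite E1 E2 -pn eqxx !mulr1; apply: (mulfI (A_neq0 p)).
have H := D_rec n; rewrite -pn Dn1 in H.
have -> : A p * (R1 n.+1 * D n + R2 n.+1) = A p * D n * R1 n.+1 + A p * R2 n.+1 by ring.
by rewrite -H; ring.
Qed.

End CycleMutation.

(** * Cyclic continued products *)

Section CyclicSums.
Variables (K : fieldType) (pos : K -> Prop).
Hypothesis sfK : semifield pos.
Variables (p : nat) (X : int -> K).
Hypotheses (p_gt1 : (1 < p)%N) (X_per : forall z, X (z + Posz p) = X z).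
Hypothesis X_pos : forall z, pos (X z).

Definition backprod (c : nat) (z : int) : K := \prod_(q < c) X (z - Posz q).
Definition cycf (z : int) : K := 1 + \sum_(c < p.-1) backprod c.+1 z.
Definition cycg (z : int) : K := X z * cycf (z - 1) / cycf z.

Local Notation T := backprod.
Local Notation f := cycf.
Local Notation g := cycg.
Local Notation F := (chainF (fun n => X (Posz n))).
Local Notation W := (\prod_(1 <= i < p.+1) X (Posz i)).

Let X_neq0 z : X z != 0. Proof. exact: (pos_neq0 sfK). Qed.

Lemma backprodS c z : T c.+1 z = X z * T c (z - 1).
Proof.
rewrite /T big_ord_recl subr0; congr (_ * _); apply: eq_bigr => q _.
by congr X; rewrite lift0; lia.
Qed.

Lemma backprodSr c z : T c.+1 z = T c z * X (z - Posz c).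
Proof. by rewrite /T big_ord_recr. Qed.

Lemma backprod_up n : T n (Posz n) = \prod_(1 <= i < n.+1) X (Posz i).
Proof.
elim: n => [|n IH]; first by rewrite big_nil /T big_ord0.
rewrite backprodS prodS -IH mulrC; congr (T _ _ * _); lia.
Qed.

Lemma backprod_shift z : T p (z + 1) = T p z.
Proof.
have -> : p = p.-1.+1 by lia.
rewrite backprodS backprodSr mulrC; congr (T _ _ * _); first lia.
by rewrite -[RHS]X_per; congr X; lia.
Qed.

Lemma backprod_full z : T p z = W.
Proof.
rewrite -backprod_up.
have shiftn n y : T p (y + Posz n) = T p y.
  by elim: n => [|n IH]; [rewrite addr0|rewrite -IH -[RHS]backprod_shift; congr (T p _); lia].
case: (lerP z (Posz p)) => zp.
  by rewrite -(shiftn `|Posz p - z|%N z); congr (T p _); lia.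
by rewrite -(shiftn `|z - Posz p|%N (Posz p)); congr (T p _); lia.
Qed.

Lemma cycf_pos z : pos (f z).
Proof.
by apply: (pos_addsum sfK) => [|c]; [exact: pos_1|apply: (pos_prod sfK)].
Qed.

Lemma cycf_neq0 z : f z != 0. Proof. exact: (pos_neq0 sfK) (cycf_pos z). Qed.

Lemma cycf_per z : f (z + Posz p) = f z.
Proof.
rewrite /f; congr (_ + _); apply: eq_bigr => c _; apply: eq_bigr => q _.
by rewrite -[RHS]X_per; congr X; lia.
Qed.

(** Multiplication by X_z lengthens each product by one factor: the empty product is lost, and a
    product of full length p appears, which is [W] whatever its starting point. *)
Lemma cycf_rec z : f z = X z * f (z - 1) + 1 - W.
Proof.
have -> : X z * f (z - 1) = \sum_(c < p.-1.+1) T c.+1 z.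
  rewrite big_ord_recl /f mulrDr mulr1 [X in _ = X + _]backprodS {2}/T big_ord0 mulr1.
  by congr (_ + _); rewrite mulr_sumr; apply: eq_bigr => c _; rewrite lift0 [RHS]backprodS.
rewrite big_ord_recr /= prednK ?backprod_full; last lia.
by rewrite /f; ring.
Qed.

Lemma cycg_pos z : pos (g z).
Proof.
apply: (pos_mul sfK); last by apply: (pos_inv sfK); apply: cycf_pos.
by apply: (pos_mul sfK) => //; apply: cycf_pos.
Qed.

Lemma cycg_neq0 z : g z != 0. Proof. exact: (pos_neq0 sfK) (cycg_pos z). Qed.

Lemma cycg_per z : g (z + Posz p) = g z.
Proof. by rewrite /g X_per cycf_per (_ : z + _ - 1 = z - 1 + Posz p) ?cycf_per //; lia. Qed.

Lemma chainF_sum n : F n = 1 + \sum_(c < n) T c.+1 (Posz n).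
Proof.
elim: n => [|n IH]; first by rewrite big_ord0 addr0.
rewrite /= IH mulrDr mulr1 big_ord_recl backprodS {2}/T big_ord0 mulr1; congr (_ + (_ + _)).
rewrite mulr_sumr; apply: eq_bigr => c _; rewrite lift0 [RHS]backprodS; congr (_ * T _ _); lia.
Qed.

Lemma chainF_pos n : pos (F n).
Proof.
elim: n => [|n IH]; first exact: pos_1.
by apply: (pos_add sfK); [exact: pos_1|apply: (pos_mul sfK)].
Qed.

Lemma chainF_neq0 n : F n != 0.
Proof. exact: (pos_neq0 sfK) (chainF_pos n). Qed.

Lemma cycf_chainF : f (Posz p.-1) = F p.-1.
Proof. by rewrite chainF_sum. Qed.

(** From p-2, only the longest product, of length p-1, passes below index 1; it picks up X_0 =
    X_p. *)
Lemma cycf_chainF2 n : p = n.+2 ->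
  f (Posz n) = F n + X (Posz p) * \prod_(1 <= i < n.+1) X (Posz i).
Proof.
move=> pn; rewrite chainF_sum /f pn /= big_ord_recr /= addrA; congr (_ + _).
rewrite backprodSr backprod_up mulrC; congr (_ * _).
by rewrite -pn -[LHS]X_per; congr X; lia.
Qed.

Definition cycG (n : nat) : K := (\prod_(j < n) g (Posz j))^-1.
Local Notation G := cycG.

Lemma cycG0 : G 0 = 1. Proof. by rewrite /G big_ord0 invr1. Qed.

Lemma cycGS n : G n.+1 = G n / g (Posz n).
Proof. by rewrite /G big_ord_recr /= invfM. Qed.

Lemma cycG_pos n : pos (G n).
Proof. by apply: (pos_inv sfK); apply: (pos_prod sfK) => j; apply: cycg_pos. Qed.

Lemma cycG_neq0 n : G n != 0. Proof. exact: (pos_neq0 sfK) (cycG_pos n). Qed.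

Let c0 := X 0 * f (-1).
Let px n := \prod_(1 <= i < n.+1) X (Posz i).

Let pxS n : px n.+1 = px n * X (Posz n.+1). Proof. exact: prodS. Qed.
Let px_neq0 n : px n != 0.
Proof. by apply: (pos_neq0 sfK); apply: (pos_prod sfK). Qed.
Let c0_neq0 : c0 != 0. Proof. by rewrite mulf_neq0 ?X_neq0 ?cycf_neq0. Qed.

(** The product of the g_j telescopes in f; [c0] collects what remains at the lower end. *)
Lemma cycG_closed n : G n.+1 = f (Posz n) / (c0 * px n).
Proof.
elim: n => [|n IH].
  rewrite cycGS cycG0 /px big_nil /c0 /g sub0r; field.
  by rewrite !X_neq0 !cycf_neq0.
rewrite cycGS IH pxS /g (_ : Posz n.+1 - 1 = Posz n); last lia.
by field; rewrite px_neq0 c0_neq0 !X_neq0 !cycf_neq0.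
Qed.

(** Both sides satisfy u_n = X_n u_(n-1) + 1 - W: [px] solves the homogeneous equation, [F] the one
    with constant term 1, and [c0] adjusts the value at 0. *)
Lemma cycf_lin n : f (Posz n) = px n * c0 + (1 - W) * F n.
Proof.
elim: n => [|n IH].
  by rewrite cycf_rec /px big_nil /c0 sub0r /= mul1r mulr1; ring.
rewrite cycf_rec pxS (_ : Posz n.+1 - 1 = Posz n); last lia.
by rewrite IH /=; ring.
Qed.

Lemma cycG_last : G p = W^-1.
Proof.
have -> : p = p.-1.+1 by lia.
rewrite cycG_closed {2}(_ : p = p.-1.+1); last lia.
rewrite prodS -/(px _) (_ : p.-1.+1 = p); last lia.
have -> : c0 = X (Posz p) * f (Posz p.-1).
  rewrite /c0 -[X 0]X_per add0r -[f (-1)]cycf_per; congr (_ * f _); lia.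
by field; rewrite px_neq0 X_neq0 cycf_neq0.
Qed.

(** This is [cycf_lin] divided by c_0 X_1 ... X_(n+1). It turns the recursion of F into that of the
    chain polynomial of the guessed seed. *)
Lemma cycG_chainF n : G n.+1 * F n.+1 = 1 + G n.+2 * (X (Posz n.+1) * F n).
Proof.
have E : X (Posz n.+1) * F n = F n.+1 - 1 by rewrite /= addrC addKr.
rewrite E.
have -> : G n.+1 = G n.+2 * g (Posz n.+1) by rewrite [G n.+2]cycGS mulfVK ?cycg_neq0.
have -> : g (Posz n.+1) = (f (Posz n.+1) - 1 + W) / f (Posz n.+1).
  by rewrite /g; congr (_ / _); rewrite [in RHS]cycf_rec; ring.
rewrite cycG_closed.
have L := cycf_lin n.+1.
set fn := f (Posz n.+1) in L *; set Fn := F n.+1 in L *.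
have fn0 : fn != 0 by apply: cycf_neq0.
apply/eqP; rewrite -subr_eq0.
have -> : fn / (c0 * px n.+1) * ((fn - 1 + W) / fn) * Fn
   - (1 + fn / (c0 * px n.+1) * (Fn - 1)) = (fn - (px n.+1 * c0 + (1 - W) * Fn)) / (c0 * px n.+1).
  by field; rewrite fn0 c0_neq0 px_neq0.
by rewrite -L subrr mul0r.
Qed.

(* The mutation factor picked up at the last vertex of [M(P)]. *)
Lemma cycG_swap n : p = n.+2 ->
  (1 + X (Posz n.+1) * F n)
  * (X (Posz p) * px n / F n) / (1 + X (Posz p) * px n / F n) = (G n.+1)^-1.
Proof.
move=> pn; rewrite cycG_closed.
have -> : 1 + X (Posz n.+1) * F n = F n.+1 by [].
have -> : F n.+1 = f (Posz n.+1) by have := cycf_chainF; rewrite pn.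
have -> : c0 = X (Posz p) * f (Posz n.+1).
  rewrite /c0 -[X 0]X_per add0r -[f (-1)]cycf_per; congr (_ * f _); lia.
have fn := cycf_chainF2 pn; rewrite -/(px n) in fn.
have f0 := cycf_neq0 (Posz n).
rewrite fn in f0 *.
field.
by rewrite px_neq0 cycf_neq0 X_neq0 f0 chainF_neq0.
Qed.

(** Companion of [cycG_swap]: the factor gained by an outer vertex per unit of positive entry at
    w_(p-1). Both follow from 1 + y = f(p-1) and 1 + z = f(p-2) / F_(p-2), y and z being the
    variables at w_(p-1) and w_p after [M(P)]. *)
Lemma cycg_swap n : p = n.+2 ->
  X (Posz n.+1) * F n * (1 + X (Posz p) * px n / F n)
  / (1 + X (Posz n.+1) * F n) = g (Posz n.+1).
Proof.
move=> pn.
have -> : 1 + X (Posz n.+1) * F n = F n.+1 by [].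
have -> : F n.+1 = f (Posz n.+1) by have := cycf_chainF; rewrite pn.
have fn := cycf_chainF2 pn; rewrite -/(px n) in fn.
rewrite /g (_ : Posz n.+1 - 1 = Posz n) ?fn; last lia.
by field; rewrite cycf_neq0 chainF_neq0.
Qed.

End CyclicSums.

(** * The cycle transformation *)

Lemma mutseq_eps (K : fieldType) (vs ws : seq V) (s s' : seed K) :
  seps s = seps s' -> seps (mutseq vs ws s) = seps (mutseq vs ws s').
Proof. by elim: ws s s' => [|v ws IH] s s' E //=; apply: IH; rewrite /= E. Qed.

Lemma seps_opp_last (K : fieldType) (vs : seq V) N w S (s : seed K) :
  balanced_cycle vs (seps s) N.+2 w S ->
  {in vs, forall u, seps (mutseq vs (cycle_seq w N) s) u (w (Posz N.+2))
    = - seps (mutseq vs (cycle_seq w N) s) u (w (Posz N.+1))}.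
Proof.
move=> bc u uV; case: (boolP (u \in cycle_seq w N.+2)) => uP.
  case/mapP: uP => i; rewrite mem_iota => hi ->.
  case: (ltnP N i) => iN; first by rewrite !(st_eps_in bc) //; lia.
  rewrite !(st_eps_past bc) //; try lia.
  by case: (i == N); lia.
rewrite !(st_eps_out bc) //; try lia.
have [-> ->] : (N.+2 == N.+1) = false /\ (N.+1 == N.+2) = false by split; lia.
by rewrite !eqxx opprB.
Qed.

Ltac nlia :=
  repeat match goal with
  | H : is_true (leq _ _) |- _ => revert H
  | H : is_true (andb _ _) |- _ => revert H
  | H : is_true (negb (@eq_op Datatypes_nat__canonical__eqtype_Equality _ _)) |- _ => revert H
  | H : @eq nat _ _ |- _ => revert H
  end; clear; intros; lia.

Section CycleTransformation.
Variables (K : fieldType) (pos : K -> Prop) (vs : seq V).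
Hypothesis sfK : semifield pos.
Variables (N : nat) (w : int -> V) (S : V -> nat -> int) (s : seed K).
Hypothesis bc : balanced_cycle vs (seps s) N.+2 w S.
Hypothesis pos_s : pos_seed pos s.

Local Notation p := N.+2.
Local Notation P := (cycle_seq w p).
Local Notation wn n := (w (Posz n)).
Local Notation mm := (fun u => runmin (S u)).
Local Notation c u j := (S u j - mm u j.-1).

Let X z := sx s (w z).
Let F := chainF (fun n => X (Posz n)).
Let f := cycf p X.
Let g := cycg p X.
Let G := cycG p X.
Let px n := \prod_(1 <= i < n.+1) X (Posz i).

Let X_per z : X (z + Posz p) = X z. Proof. by rewrite /X (bc_per bc). Qed.
Let X_pos z : pos (X z). Proof. exact: (proj1 pos_s). Qed.
Let X_neq0 z : X z != 0. Proof. exact: (pos_neq0 sfK). Qed.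
Let F_neq0 n : F n != 0. Proof. exact: (chainF_neq0 sfK). Qed.
Let g_pos z : pos (g z). Proof. exact: cycg_pos. Qed.
Let g_neq0 z : g z != 0. Proof. exact: (pos_neq0 sfK). Qed.
Let G_neq0 n : G n != 0. Proof. exact: (cycG_neq0 sfK). Qed.
Let px_neq0 n : px n != 0.
Proof. by apply: (pos_neq0 sfK); apply: (pos_prod sfK). Qed.
Let GS n : G n.+1 = G n / g (Posz n). Proof. exact: cycGS. Qed.

Definition cycQ (i : nat) : K :=
  (sa s (wn i) * sa s (wn i.+1))^-1
  * \prod_(u <- vs | u \notin P) sa s u ^ S u i.
Definition cycA : K := \sum_(i < p) cycQ i.

(** [index] counts from 0 while [P] starts at w_1, so the two factors at u = w_j are g_j and
    g_(j-1). *)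
Definition cycX (u : V) : K :=
  if u \in P then
    sx s u / (g (Posz (index u P).+1) * g (Posz (index u P)))
  else sx s u * \prod_(0 <= j < p) g (Posz j) ^ S u j.

Definition Rtarget : seed K :=
  Seed (seps s) cycX (fun u => if u \in P then cycA * sa s u else sa s u).

Lemma cycQ_pos i : pos (cycQ i).
Proof.
apply: (pos_mul sfK); last by apply: (pos_prod sfK) => u; apply: (pos_exprz sfK); case: pos_s.
by apply: (pos_inv sfK); apply: (pos_mul sfK); case: pos_s.
Qed.

Lemma cycA_pos : pos cycA.
Proof. by rewrite /cycA big_ord_recl; apply: (pos_addsum sfK) => [|i]; apply: cycQ_pos. Qed.

Let cycA_neq0 : cycA != 0. Proof. exact: (pos_neq0 sfK) cycA_pos. Qed.

Lemma Rtarget_pos : pos_seed pos Rtarget.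
Proof.
split=> u /=.
  rewrite /cycX; case: ifP => _; apply: (pos_mul sfK); try exact: (proj1 pos_s).
    by apply: (pos_inv sfK); apply: (pos_mul sfK).
  by apply: (pos_prod sfK) => j; apply: (pos_exprz sfK).
case: ifP => _; last exact: (proj2 pos_s).
by apply: (pos_mul sfK); [exact: cycA_pos|exact: (proj2 pos_s)].
Qed.

Let bc' : balanced_cycle vs (seps Rtarget) p w S := bc.

Lemma cycle_uniq : uniq P.
Proof.
rewrite map_inj_in_uniq ?iota_uniq // => i j; rewrite !mem_iota => hi hj.
by apply: (bc_inj bc); nlia.
Qed.

Lemma index_cycle i : (0 < i <= p)%N -> index (wn i) P = i.-1.
Proof.
move=> hi; have -> : wn i = nth (wn 0) P i.-1.
  by rewrite (nth_map 0%N) ?size_iota ?nth_iota; [congr (w (Posz _))| |]; nlia.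
by rewrite index_uniq ?cycle_uniq // size_map size_iota; nlia.
Qed.

Lemma Rtarget_x i : (0 < i <= p)%N ->
  sx Rtarget (wn i) = X (Posz i) / (g (Posz i) * g (Posz i - 1)).
Proof.
move=> hi; rewrite /= /cycX (w_inP bc) // index_cycle // prednK; last nlia.
by congr (_ / (_ * g _)); nlia.
Qed.

Let X' i := sx Rtarget (wn i).
Let F' := chainF X'.

Lemma RtargetF n : (n <= p)%N -> F' n = G n * F n.
Proof.
elim: n => [|n IH] np; first by rewrite /F' /F /G cycG0 mulr1.
rewrite /F' /= -/F' IH; last nlia.
rewrite /G (@cycG_chainF _ _ sfK) // -/G -/F [X' _]Rtarget_x; last nlia.
rewrite (_ : Posz n.+1 - 1 = Posz n); last nlia.
by rewrite !GS; field; rewrite !g_neq0.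
Qed.

Lemma RtargetY n : (n.+1 <= p)%N -> X' n.+1 * F' n = G n.+2 * (X (Posz n.+1) * F n).
Proof.
move=> np; have H := @RtargetF n.+1 np.
rewrite /F' /= -/F' /G (@cycG_chainF _ _ sfK) // -/G -/F in H.
exact: addrI H.
Qed.

Lemma Rtarget_px n : (n <= p)%N ->
  X' p * \prod_(1 <= i < n.+1) X' i
  = X (Posz p) * px n * G n.+1 * G n / g (Posz N.+1).
Proof.
have gp : g (Posz p) = g 0 by rewrite -[g 0]cycg_per // add0r.
elim: n => [|n IH] np.
  rewrite /px !big_nil [X' _]Rtarget_x; last nlia.
  rewrite (_ : Posz p - 1 = Posz N.+1) ?gp; last nlia.
  by rewrite GS /G cycG0; field; rewrite !g_neq0.
rewrite prodS mulrA IH; last nlia.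
rewrite {2}/px prodS -/(px n) [X' _]Rtarget_x; last nlia.
rewrite (_ : Posz n.+1 - 1 = Posz n); last nlia.
by rewrite !GS; field; rewrite !g_neq0.
Qed.

Let sM := mutseq vs (cycle_seq w N) s.
Let tM := mutseq vs (cycle_seq w N) Rtarget.
Let mid := swap_seed (wn N.+1) (wn p) (mutate vs (wn p) (mutate vs (wn N.+1) sM)).
Let y := X (Posz N.+1) * F N.
Let z := X (Posz p) * px N / F N.

Let sMa : sx sM (wn N.+1) = y.
Proof. exact: (st_x_succ sfK bc pos_s (leqnn _)). Qed.
Let sMb : sx sM (wn p) = z.
Proof. exact: (st_x_last sfK bc pos_s (leqnn _)). Qed.

Let yzG : (1 + y) * z / (1 + z) = (G N.+1)^-1.
Proof. exact: (@cycG_swap _ _ sfK p X). Qed.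
Let yzg : y * (1 + z) / (1 + y) = g (Posz N.+1).
Proof. exact: (@cycg_swap _ _ sfK p X). Qed.

Let wab : wn N.+1 != wn p. Proof. by apply: (w_neq bc); nlia. Qed.
Let skewM : skew_seed vs sM. Proof. exact: (st_skew bc). Qed.
Let posM : pos_seed pos sM. Proof. exact: mutseq_pos. Qed.
Let aV : wn N.+1 \in vs. Proof. exact: (bc_mem bc). Qed.
Let bV : wn p \in vs. Proof. exact: (bc_mem bc). Qed.
Let oppM := seps_opp_last bc.

(** The guess starts from the product of all g_j^(S_u j). Each mutation absorbs one more of these
    powers into a power of G, whose exponent is governed by the running minimum. *)
Lemma Rtarget_x_out u n : u \in vs -> u \notin P -> (n <= N)%N ->
  sx (mutseq vs (cycle_seq w n) Rtarget) u =
  sx (mutseq vs (cycle_seq w n) s) u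
  * (G n.+1 ^ (- mm u n) * \prod_(n.+1 <= j < p) g (Posz j) ^ S u j).
Proof.
move=> uV uP nN.
rewrite (st_x_out sfK bc' Rtarget_pos) // (st_x_out sfK bc pos_s) //.
rewrite -/X' -/F' -/F /= /cycX (negPf uP) -!mulrA; congr (_ * _).
elim: n nN => [|n IH] nN.
  rewrite !big_nil mulr1 mul1r big_ltn //; congr (_ * _).
  by rewrite GS /G cycG0 div1r exprz_inv opprK.
rewrite !prodS mulrA IH; last nlia.
rewrite -[X' n.+1 * _]/(X' n.+1 * F' n) RtargetY; last nlia.
rewrite RtargetF; last nlia.
rewrite -[n.+1.-1]/n -[sx s (wn n.+1)]/(X (Posz n.+1)) !expfzMl [\prod_(n.+1 <= j < p) _]big_ltn; last nlia.
have E : g (Posz n.+1) = G n.+1 * (G n.+2)^-1.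
  by rewrite [G n.+2]GS; field; rewrite G_neq0 g_neq0.
(* By [E], only powers of G_(n+1) and G_(n+2) occur: the exponents of the former cancel, and those
   of the latter add up to minus the updated minimum. *)
have H : G n.+1 ^ (- mm u n) * (g (Posz n.+1) ^ S u n.+1)
   * (G n.+2 ^ ppart (c u n.+1) * G n.+1 ^ (- c u n.+1)) = G n.+2 ^ (- mm u n.+1).
  rewrite E expfzMl exprz_inv.
  have -> : G n.+1 ^ (- mm u n) * (G n.+1 ^ S u n.+1 * G n.+2 ^ (- S u n.+1))
     * (G n.+2 ^ ppart (c u n.+1) * G n.+1 ^ (- c u n.+1))
     = (G n.+1 ^ (- mm u n) * G n.+1 ^ S u n.+1 * G n.+1 ^ (- c u n.+1))
       * (G n.+2 ^ (- S u n.+1) * G n.+2 ^ ppart (c u n.+1)) by ring.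
  rewrite exprz_cancel3 ?G_neq0 // ?mul1r; last by rewrite /=; nlia.
  rewrite -expfzDr ?G_neq0 //; congr (_ ^ _); rewrite /=; nlia.
by rewrite -H -[n.+1.-1]/n; ring.
Qed.

Let swap_out u : u \in vs -> u \notin P ->
  (y ^ ppart (c u N.+1) * (1 + y) ^ (- c u N.+1))
  * (z ^ ppart (- c u N.+1) * (1 + z) ^ (c u N.+1))
  = G N.+1 ^ (- mm u N) * g (Posz N.+1) ^ S u N.+1.
Proof.
move=> uV uP; have /= m0 := runmin_last bc uV uP.
move: (runmin (S u) N) (S u N.+1) m0 => m S1 m0.
(* Because the minimum of [m] and [S1] is 0, the sign of their difference tells which one vanishes;
   [yzg] settles the first case and, together with [yzG], the second. *)
case: (lerP 0 (S1 - m)) => hc.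
  have -> : m = 0 by (clear -m0 hc; lia).
  have -> : ppart (- (S1 - 0)) = 0 by (clear -m0 hc; lia).
  by rewrite subr0 oppr0 !expr0z !mul1r -yzg !expfzMl exprz_inv; ring.
have -> : S1 = 0 by (clear -m0 hc; lia).
have -> : ppart (- (0 - m)) = m by (clear -m0 hc; lia).
by rewrite sub0r opprK !expr0z mul1r mulr1 -[G N.+1 ^ _]exprz_inv -yzG !expfzMl !exprz_inv; ring.
Qed.

Lemma swap_eqv_x u : u \in vs -> sx mid u = sx tM u.
Proof.
move=> uV; case: (boolP (u \in P)) => uP; last first.
  have ua : u != wn N.+1 by apply: (out_neq bc uP); nlia.
  have ub : u != wn p by apply: (out_neq bc uP); nlia.
  rewrite /mid (swap_mutate_x sfK skewM posM) // sMa sMb.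
  rewrite (st_eps_out_next bc) // Rtarget_x_out // -mulrA; congr (_ * _).
  by rewrite swap_out // big_nat1.
case/mapP: uP uV => j; rewrite mem_iota => hj -> _.
have [jN|jN] := leqP j N.
  have hj' : (0 < j <= N)%N by nlia.
  have ja : wn j != wn N.+1 by apply: (w_neq bc); nlia.
  have jb : wn j != wn p by apply: (w_neq bc); nlia.
  have jV : wn j \in vs by apply: (bc_mem bc).
  rewrite /mid (swap_mutate_x sfK skewM posM) // sMa sMb.
  rewrite (st_x_past sfK bc) // (st_x_past sfK bc' Rtarget_pos) // -/X' -/F' -/F.
  have [j' jE] : exists j', j = j'.+1 by exists j.-1; nlia.
  rewrite jE in hj' jN *; rewrite RtargetY; last nlia.
  rewrite -[j'.+1.-1]/j' -[sx s (wn j'.+1)]/(X (Posz j'.+1)).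
  rewrite (st_eps_past bc) //; last nlia.
  rewrite eqxx (_ : (N.+1 == p) = false); last nlia.
  (* Among the mutated vertices only w_N is still joined to the two swapped ones. *)
  case: (eqVneq j'.+1 N) => [jN'|jN'].
    rewrite jN' ltnn !mulr1 !invfM -yzG -jN' /=; rewrite expr0z mul1r.
    by rewrite !expr1z ?exprN1; ring.
  rewrite (_ : (j'.+1 < N)%N); last nlia.
  rewrite !oppr0 !expr0z !mulr1 RtargetF; last nlia.
  by field; rewrite !G_neq0 !F_neq0 !X_neq0.
have [->|->] : j = N.+1 \/ j = p by nlia.
  rewrite /mid (swap_mutate_x_l sfK skewM posM) // sMb.
  rewrite (st_x_succ sfK bc' Rtarget_pos) // -/X' -/F' RtargetY //.
  rewrite /G (@cycG_last _ _ sfK) // prodS prodS -/(px N) /z.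
  by field; rewrite !F_neq0 !X_neq0 px_neq0.
rewrite /mid (swap_mutate_x_r sfK skewM posM) // sMa.
rewrite (st_x_last sfK bc' Rtarget_pos) // -/X' -/F' Rtarget_px //; last nlia.
rewrite RtargetF; last nlia.
have GN : G N.+1 / g (Posz N.+1) = (px N * X (Posz N.+1) * X (Posz p))^-1.
  by rewrite -GS /G (@cycG_last _ _ sfK) // !prodS.
have -> : X (Posz p) * px N * G N.+1 * G N / g (Posz N.+1) / (G N * F N)
  = X (Posz p) * px N * G N / (G N * F N) * (G N.+1 / g (Posz N.+1)).
  by field; rewrite g_neq0 F_neq0 G_neq0.
by rewrite GN /y; field; rewrite !F_neq0 !X_neq0 px_neq0 G_neq0.
Qed.

Lemma swap_eqv_a u : u \in vs -> sa mid u = sa tM u.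
Proof.
move=> uV; case: (boolP (u \in P)) => uP; last first.
  have ua : u != wn N.+1 by apply: (out_neq bc uP); nlia.
  have ub : u != wn p by apply: (out_neq bc uP); nlia.
  rewrite /mid swap_mutate_a // (st_a_out bc) //; last nlia.
  by rewrite (st_a_out bc') //= ?(negPf uP) //; nlia.
have AE j : (0 < j <= p)%N -> sa Rtarget (wn j) = cycA * sa s (wn j).
  by move=> hj; rewrite /= (w_inP bc).
have a0 v : sa s v != 0 by apply: (pos_neq0 sfK); case: pos_s.
have E : \prod_(j <- vs) sa sM j ^ ppart (seps sM (wn N.+1) j)
   + \prod_(j <- vs) sa sM j ^ ppart (- seps sM (wn N.+1) j)
   = sa s (wn N.+1) * sa s (wn p) * cycA.
  by have := st_a_swap sfK bc pos_s; rewrite !subSS !subn0.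
case/mapP: uP uV => j; rewrite mem_iota => hj -> _.
have [jN|jN] := leqP j N.
  have hj' : (0 < j <= N)%N by nlia.
  have ja : wn j != wn N.+1 by apply: (w_neq bc); nlia.
  have jb : wn j != wn p by apply: (w_neq bc); nlia.
  rewrite /mid swap_mutate_a // (st_a_past sfK bc) // (st_a_past sfK bc' Rtarget_pos) //.
  cbv beta; rewrite !AE; try nlia.
  have oE (x : V -> int) : \prod_(v <- vs | v \notin P) sa Rtarget v ^ x v
     = \prod_(v <- vs | v \notin P) sa s v ^ x v.
    by apply: eq_bigr => v /negPf vP; rewrite /= vP.
  rewrite oE.
  (* Scaling the cycle by [cycA] divides the partial sum by the square of [cycA] and multiplies the
     prefactor A_(j+1) A_p by it: both seeds carry the same variable at w_j. *)
  have sE : \sum_(i < j.+1) (sa Rtarget (wn i) * sa Rtarget (wn i.+1))^-1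
      * (\prod_(v <- vs | v \notin P) sa Rtarget v ^ S v i)
    = (cycA * cycA)^-1 * \sum_(i < j.+1) (sa s (wn i) * sa s (wn i.+1))^-1
      * (\prod_(v <- vs | v \notin P) sa s v ^ S v i).
    rewrite mulr_sumr; apply: eq_bigr => i _; rewrite oE (AE i.+1); last by have := ltn_ord i; nlia.
    have -> : sa Rtarget (wn i) = cycA * sa s (wn i).
      case: (posnP i) => [->|i0]; last by apply: AE; have := ltn_ord i; nlia.
      by rewrite -[w 0](bc_per bc) add0r AE //; nlia.
    by rewrite !invfM; ring.
  by rewrite sE; field.
have [->|->] : j = N.+1 \/ j = p by nlia.
  rewrite /mid (swap_mutate_a_l skewM) // E (st_a_next bc) //; last nlia.
  rewrite (st_a_next bc') ?AE //; try nlia.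
  by field.
rewrite /mid swap_mutate_a_r // E (st_a_next bc) //; last nlia.
rewrite (st_a_next bc') ?AE //; try nlia.
by field.
Qed.

Theorem Rmut_cycle : seed_eqv vs (Rmut vs P s) Rtarget.
Proof.
have -> : Rmut vs P s = mutseq vs (rev (cycle_seq w N)) mid.
  rewrite /Rmut size_map size_iota !subSS !subn0.
  rewrite !(nth_map 0%N) ?size_iota ?nth_iota //; try nlia.
  by rewrite -map_take take_iota (_ : minn N p = N) //; nlia.
have sub := cycle_seq_sub bc (n := N).
have tK := @mutseqK _ _ _ sfK _ Rtarget sub (bc_skew bc') Rtarget_pos.
apply: (seed_eqv_trans _ tK).
apply: mutseq_eqv; first by move=> u; rewrite mem_rev; apply: sub.
split=> [u v uV vV|u uV|u uV]; [|exact: swap_eqv_x|exact: swap_eqv_a].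
rewrite /mid swap_mutate_eps // (_ : seps tM = seps sM) //.
exact: mutseq_eps.
Qed.

End CycleTransformation.

Theorem Rmut_balanced (K : fieldType) (pos : K -> Prop) (vs : seq V) p w S (s : seed K) :
  semifield pos -> balanced_cycle vs (seps s) p w S -> pos_seed pos s ->
  let P := cycle_seq w p in
  let s' := Rmut vs P s in
  let X z := sx s (w z) in
  let g := cycg p X in
  [/\ {in vs &, forall u v, seps s' u v = seps s u v},
      forall j : nat, (0 < j <= p)%N ->
        sx s' (w j) = cycf p X j%:Z / (X (j%:Z - 1) * cycf p X (j%:Z - 2)),
      forall u, u \in vs -> u \notin P ->
        sx s' u = sx s u * \prod_(0 <= j < p) g j%:Z ^ S u j,
      forall j : nat, (0 < j <= p)%N -> sa s' (w j) = sa s (w j) *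
        \sum_(i < p) (sa s (w i) * sa s (w i.+1))^-1
                     * \prod_(u <- vs | u \notin P) sa s u ^ S u i
    & forall u, u \in vs -> u \notin P -> sa s' u = sa s u].
Proof.
move=> sfK; case: p => [|[|N]] bc pos_s P s' X g; try by have := bc_size bc.
have [Ee Ex Ea] := Rmut_cycle sfK bc pos_s.
have wV z := bc_mem bc z.
have Xpos z : pos (X z) by exact: (proj1 pos_s).
split=> [||u uV uP|j hj|u uV uP].
- by move=> u v uV vV; rewrite /s' Ee.
- move=> j hj; rewrite Ex // Rtarget_x //.
  rewrite -[LHS]/(X j%:Z / (cycg N.+2 X j%:Z * cycg N.+2 X (j%:Z - 1))) /cycg.
  rewrite (_ : j%:Z - 1 - 1 = j%:Z - 2); last by ring.
  by field; rewrite !(cycf_neq0 sfK) // !(pos_neq0 sfK).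
- by rewrite Ex //= /cycX (negPf uP).
- by rewrite Ea //= (w_inP bc) // mulrC.
- by rewrite Ea //= (negPf uP).
Qed.

(** * The quivers of the finite types *)

Section FractionPositivity.
Variable n : nat.

Definition frac_pos (x : {fraction {mpoly rat[n]}}) : Prop :=
  exists a b : {mpoly rat[n]},
    [/\ 0 < a.@[fun=> 1], 0 < b.@[fun=> 1] & x = tofrac a / tofrac b].

Let meval_neq0 (a : {mpoly rat[n]}) : 0 < a.@[fun=> 1] -> tofrac a != 0.
Proof.
rewrite tofrac_eq0; apply: contraTneq => ->.
by rewrite meval0 ltxx.
Qed.

Lemma frac_pos_semifield : semifield frac_pos.
Proof.
split.
- by exists 1, 1; rewrite meval1 tofrac1 divr1.
- move=> _ _ [a [b [a0 b0 ->]]] [c [d [c0 d0 ->]]].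
  exists (a * d + c * b), (b * d); rewrite mevalD !mevalM; split.
  + by rewrite addr_gt0 // mulr_gt0.
  + by rewrite mulr_gt0.
  + by rewrite tofracD !tofracM addf_div ?meval_neq0.
- move=> _ _ [a [b [a0 b0 ->]]] [c [d [c0 d0 ->]]].
  exists (a * c), (b * d); rewrite !mevalM !mulr_gt0 //; split=> //.
  by rewrite !tofracM mulf_div.
- move=> _ [a [b [a0 b0 ->]]]; exists b, a; split=> //.
  by rewrite invfM invrK mulrC.
- by move=> _ [a [b [a0 b0 ->]]]; rewrite mulf_neq0 ?invr_neq0 ?meval_neq0.
Qed.

Lemma frac_pos_var (i : 'I_n) : frac_pos (tofrac 'X_i).
Proof.
by exists 'X_i, 1; rewrite mevalXU meval1 tofrac1 divr1.
Qed.

End FractionPositivity.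

Lemma eqmE T a b : eqm T a b = (T%:Z %| a - b)%Z.
Proof. exact: eqz_mod_dvd. Qed.

Lemma eqm_sub T a b c d : a - b = c - d -> eqm T a b = eqm T c d.
Proof. by rewrite !eqmE => ->. Qed.

Lemma eqm_sym T a b : eqm T a b = eqm T b a.
Proof. by rewrite /eqm eq_sym. Qed.

Lemma eqm_refl T a : eqm T a a.
Proof. exact: eqxx. Qed.

Lemma eqm_modl T a b : eqm T (a %% T)%Z b = eqm T a b.
Proof. by rewrite /eqm modz_mod. Qed.

Lemma eqm_modr T a b : eqm T a (b %% T)%Z = eqm T a b.
Proof. by rewrite /eqm modz_mod. Qed.

Lemma eqm_small T a b : `|a - b| < T%:Z -> eqm T a b = (a == b).
Proof.
move=> h; rewrite eqmE; apply/idP/eqP => [/dvdzP[q E]|->]; last by rewrite subrr dvdz0.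
have T0 : 0 < T%:Z by lia.
move: h; rewrite E normrM (gtr0_norm T0) gtr_pMl // => q1.
have q0 : q = 0 by lia.
by move: E; rewrite q0 mul0r; lia.
Qed.

Definition dspan (k : ltype) (l i j : nat) := maxn (ee k l i) (ee k l j).

(* For [j] adjacent to [i], the arrows between [(j, t)] and the vertices [(i, _)] leave
   [(j, t)] towards time [t - doffset] and come from time [t - doffset + dspan]. *)
Definition doffset (k : ltype) (l i j : nat) : nat :=
  if halfd k && (ee k l i != ee k l j) then 1
  else if (j < i)%N then dspan k l i j else 0.

(** For adjacent i and j this is -C_ij, since (alpha_i, alpha_j) = -max(d_i, d_j). *)
Definition dmult (k : ltype) (l i j : nat) := (dspan k l i j %/ ee k l i)%N.

Lemma dynadj_irrefl k l i : dynadj k l i i = false.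
Proof. rewrite /dynadj minnn maxnn; case: k; lia. Qed.

Ltac decide_nat :=
  repeat match goal with
  | |- context [(?x <= ?y)%N] =>
      lazymatch y with addn _ _ => fail | _ => idtac end;
      first [rewrite (_ : (x <= y)%N = true); last by lia
            |rewrite (_ : (x <= y)%N = false); last by lia]
  | |- context [@eq_op Datatypes_nat__canonical__eqtype_Equality ?x ?y] =>
      first [rewrite (_ : (x == y) = true); last by lia
            |rewrite (_ : (x == y) = false); last by lia]
  end.

Ltac norm_at a :=
  repeat match goal with |- context [a ?c] =>
    let c' := eval vm_compute in c in progress change (a c) with (a c') end.

Ltac case_at a :=
  repeat match goal with |- context [a ?c] => case: (a c) end.

Lemma dynadjC k l i j : dynadj k l i j = dynadj k l j i.
Proof. by rewrite /dynadj minnC maxnC. Qed.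

Lemma ord_cases4 (i : nat) : (0 < i <= 4)%N -> [\/ i = 1, i = 2, i = 3 | i = 4]%N.
Proof. by case: i => [|[|[|[|[|]]]]] //; constructor. Qed.

Lemma ord_cases2 (i : nat) : (0 < i <= 2)%N -> i = 1%N \/ i = 2%N.
Proof. by case: i => [|[|[|]]] // _; [left|right]. Qed.

Section EpsQ.
Variables (T : nat) (t s : int).
Let a c := eqm T s (t + c).

Lemma eqm_shiftE :
  [/\ forall c, eqm T t (s + c) = a (- c), forall c, eqm T t (s - c) = a c,
      eqm T s t = a 0 /\ eqm T t s = a 0,
      forall c, eqm T s (t - c) = a (- c) &
      forall c d, eqm T s (t - c + d) = a (d - c)].
Proof.
have E0 c : eqm T t (s + c) = a (- c) by rewrite eqm_sym; apply: eqm_sub; lia.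
split=> // [c||c d].
- by rewrite E0 opprK.
- by rewrite (eqm_sym T t s) /a addr0.
- by rewrite /a; congr eqm; lia.
Qed.

Lemma epsQ_same k l i : valid_type k l -> (1 <= i <= l)%N ->
  epsQ k l T (i, t) (i, s) =
  (eqm T s (t + (ee k l i)%:Z))%:Z - (eqm T t (s + (ee k l i)%:Z))%:Z.
Proof.
move=> vk hi; rewrite /epsQ /narr /ee /cedge dynadj_irrefl.
have [E0 E1 [E2 E3] E4 E5] := eqm_shiftE.
rewrite E0 -![eqm T s (t + _)]/(a _).
case: k vk => vk; rewrite -?[eqm T s (t + _)]/(a _) ?E0 ?E1 ?E2 ?E3 ?E4; move: (a) => b.
1,4,5: by decide_nat; rewrite ?andbF /=; norm_at b; case_at b.
1,2: by case: (ltnP i l) => il; decide_nat; rewrite /= ?andbF; norm_at b; case_at b.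
- by rewrite (eqP vk) in hi; have [] := ord_cases4 hi => -> /=; norm_at b; case_at b.
- by rewrite (eqP vk) in hi; have [] := ord_cases2 hi => -> /=; norm_at b; case_at b.
Qed.

Lemma epsQ_neq k l i j :
  valid_type k l -> (1 <= i <= l)%N -> (1 <= j <= l)%N -> j != i ->
  epsQ k l T (j, t) (i, s) = if dynadj k l i j then
    (eqm T s (t - (doffset k l i j)%:Z))%:Z
    - (eqm T s (t - (doffset k l i j)%:Z + (dspan k l i j)%:Z))%:Z else 0.
Proof.
move=> vk hi hj ji; rewrite /epsQ /narr /doffset /dspan /ee /cedge.
have [E0 E1 [E2 E3] E4 E5] := eqm_shiftE.
rewrite (dynadjC _ l j i).
case: k vk => vk; rewrite -?[eqm T s (t + _)]/(a _) ?E0 ?E1 ?E2 ?E3 ?E4 ?E5; move: (a) => b; clear E0 E1 E2 E3 E4 E5.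
(* In types A, D, E the arrows depend only on adjacency and on the order of the labels, so the shape
   of the diagram is never inspected. *)
1,4,5: by case: (dynadj _ _ _ _); case: (ltngtP j i) ji => // hij _; decide_nat; rewrite /=; norm_at b; case_at b.
1,2: case: (ltnP i l) => il; case: (ltnP j l) => jl; try (exfalso; lia);
  case: (ltngtP j i) ji => // hij _; rewrite /dynadj;
  case: (eqVneq i j.+1) => hij1; case: (eqVneq j i.+1) => hij2; try (exfalso; lia);
  by decide_nat; rewrite /= ?andbF; norm_at b; case_at b.
- rewrite (eqP vk) in hi hj *; have [] := ord_cases4 hi; have [] := ord_cases4 hj;
    move=> Ej Ei; rewrite Ei Ej in ji * => //=; by norm_at b; case_at b.
- rewrite (eqP vk) in hi hj *; have [] := ord_cases2 hi; have [] := ord_cases2 hj;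
    move=> Ej Ei; rewrite Ei Ej in ji * => //=; by norm_at b; case_at b.
Qed.

End EpsQ.

Lemma ee_gt0 k l i : (0 < ee k l i)%N.
Proof. by rewrite /ee; case: k => //; case: ifP. Qed.

Lemma ee_dvd k l i : (ee k l i %| unitc k)%N.
Proof. by rewrite /ee; case: k => //; case: ifP. Qed.

Lemma dmult_ee k l i j : (dmult k l i j * ee k l i)%N = dspan k l i j.
Proof. by rewrite /dmult /dspan /ee; case: k => //=; do 2 case: ifP => _. Qed.

Lemma dspan_le k l i j : (dspan k l i j <= unitc k)%N.
Proof. by rewrite /dspan /ee; case: k => //=; do 2 case: ifP => _. Qed.

Lemma mem_verts l T u :
  (u \in verts l T) = (0 < u.1 <= l)%N && (0 <= u.2 < T%:Z).
Proof.
apply/allpairsP/idP => [[[j t] /= [hj ht ->]]|].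
  by move: hj ht; rewrite !mem_iota /=; lia.
case: u => j [t|t] /=; last by lia.
move=> h; exists (j, t); rewrite /= !mem_iota; split=> //; lia.
Qed.

Lemma verts_uniq l T : uniq (verts l T).
Proof.
apply: allpairs_uniq; rewrite ?iota_uniq // => [[j t] [j' t']] _ _ /= [-> h].
by congr pair; lia.
Qed.

Lemma eqm_ltn p (x y : nat) : (0 < x <= p)%N -> (0 < y <= p)%N ->
  eqm p x%:Z y%:Z = (x == y).
Proof. by move=> hx hy; rewrite eqm_small; lia. Qed.

Lemma eqm_succ p (x y : nat) : (1 < p)%N -> (0 < x <= p)%N -> (0 < y <= p)%N ->
  (eqm p y%:Z (x%:Z + 1))%:Z = (y == x.+1)%:Z + ((x == p) && (y == 1%N))%:Z.
Proof.
move=> p1 hx hy; have [->|xp] := eqVneq x p.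
  have -> : eqm p y (p%:Z + 1) = eqm p y 1%N.
    rewrite !eqmE (_ : y%:Z - (p%:Z + 1) = y%:Z - 1%N%:Z - p%:Z); last lia.
    by rewrite rpredBr // dvdzz.
  by rewrite eqm_ltn; lia.
by rewrite -[x%:Z + 1]/(x%:Z + 1%:Z) -PoszD addn1 eqm_ltn; lia.
Qed.

Lemma sum_telescope (F : nat -> int) n :
  \sum_(q < n) F q - \sum_(q < n) F q.+1 = F 0%N - F n.
Proof.
elim: n => [|n IH]; first by rewrite !big_ord0; lia.
by rewrite !big_ord_recr opprD addrACA IH /= addrA subrK.
Qed.

(** * The cycles of [Q_m(g)] are balanced *)

Section QuiverCycle.
Variables (k : ltype) (l m i t0 : nat).
Hypotheses (vk : valid_type k l) (m_gt1 : (1 < m)%N) (hi : (1 <= i <= l)%N).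

Local Notation T := (Tn k m).
Local Notation e := (ee k l i).
Local Notation p := (T %/ e)%N.
Local Notation vs := (verts l T).
Local Notation dt j := (doffset k l i j).
Local Notation r j := (dmult k l i j).

Definition cvert (z : int) : V := nrm T (i, t0%:Z + e%:Z * z).

(** The window of [dmult] consecutive positions that starts at the head of the arrow leaving u and
    ends just before the tail of the arrow entering u. Its increments give the two indicators of
    [epsQ_neq], because the span is [dmult] steps of length e. *)
Definition cprofile (u : V) (n : nat) : int :=
  if dynadj k l i u.1 then
    \sum_(q < r u.1) (eqm T (t0%:Z + e%:Z * n%:Z) (u.2 - (dt u.1)%:Z + q%:Z * e%:Z))%:Z
  else 0.

Let e_gt0 : (0 < e)%N := ee_gt0 k l i.

Lemma cycle_length : (p * e)%N = T.
Proof. by rewrite divnK // /Tn dvdn_mulr // ee_dvd. Qed.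

Let unitc_gt0 : (0 < unitc k)%N. Proof. by case: (k). Qed.

(** From m > 1: the span is at most [unitc k], which is less than T = p e. Windows therefore never
    fill the cycle, and p > 1. *)
Lemma dmult_lt j : (r j < p)%N.
Proof.
rewrite -(ltn_pmul2r e_gt0) dmult_ee cycle_length /Tn.
by apply: leq_ltn_trans (dspan_le k l i j) _; rewrite -{1}[unitc k]muln1 ltn_pmul2l.
Qed.

Lemma period_gt1 : (1 < p)%N.
Proof.
apply: leq_ltn_trans (dmult_lt i); rewrite -(leq_pmul2r e_gt0) dmult_ee mul1n.
exact: leq_maxl.
Qed.

Let p_gt1 := period_gt1.
Let T_gt0 : (0 < T)%N. Proof. by rewrite -cycle_length muln_gt0 e_gt0; lia. Qed.

Let TZ : T%:Z = p%:Z * e%:Z. Proof. by rewrite -PoszM cycle_length. Qed.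

Lemma eqm_cycle x y : eqm T (t0%:Z + e%:Z * x) (t0%:Z + e%:Z * y) = eqm p x y.
Proof.
rewrite !eqmE TZ.
have -> : t0%:Z + e%:Z * x - (t0%:Z + e%:Z * y) = (x - y) * e%:Z by ring.
by rewrite dvdz_mul2r //; lia.
Qed.

Lemma nrm_eq j (x y : int) : (nrm T (j, x) == nrm T (j, y)) = eqm T x y.
Proof. by rewrite /nrm /= xpair_eqE eqxx. Qed.

Lemma cvert_eq x y : (cvert x == cvert y) = eqm p x y.
Proof. by rewrite nrm_eq eqm_cycle. Qed.

Lemma cvert_mem z : cvert z \in vs.
Proof. by rewrite mem_verts /= hi modz_ge0 ?ltz_pmod //; lia. Qed.

Lemma cvert_per z : cvert (z + p%:Z) = cvert z.
Proof. by apply/eqP; rewrite cvert_eq eqmE addrAC subrr add0r dvdzz. Qed.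

Lemma cvert_in z : cvert z \in cycle_seq cvert p.
Proof.
have h1 : 0 <= ((z - 1) %% p)%Z by rewrite modz_ge0; lia.
have h2 : ((z - 1) %% p)%Z < p%:Z by rewrite ltz_pmod; lia.
apply/mapP; exists (`|((z - 1) %% p)%Z|.+1)%N; first by rewrite mem_iota; lia.
apply/eqP; rewrite cvert_eq (_ : Posz _ = ((z - 1) %% p)%Z + 1); last lia.
rewrite (@eqm_sub _ _ _ (z - 1) ((z - 1) %% p)%Z) ?eqm_modr ?eqm_refl //; lia.
Qed.

Lemma cyc_cvert : cyc k l m i t0 = cycle_seq cvert p.
Proof. by apply: eq_map => c; rewrite /cvert PoszD PoszM. Qed.

Lemma mem_cycle j (t : int) : 0 <= t < T%:Z ->
  ((j, t) \in cycle_seq cvert p) = (j == i) && eqm e t t0%:Z.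
Proof.
move=> ht; apply/idP/andP => [/mapP[c _ [-> ->]]|[/eqP -> et]].
  split=> //; rewrite eqmE.
  have := divz_eq (t0%:Z + e%:Z * c%:Z) T%:Z; set z := (_ %/ _)%Z; set y := (_ %% _)%Z => E.
  have -> : y - t0%:Z = (c%:Z - z * p%:Z) * e%:Z.
    by apply/(addrI (z * T%:Z))/eqP; rewrite addrA -E TZ; apply/eqP; ring.
  exact: dvdz_mull.
move: et; rewrite eqmE => /dvdzP[z E].
have -> : (i, t) = cvert z; last exact: cvert_in.
rewrite /cvert /nrm /=; congr pair.
have -> : t0%:Z + e%:Z * z = t by rewrite mulrC -E; lia.
by rewrite modz_small.
Qed.

Lemma eqm_dvd (x y : int) : eqm T x y -> eqm e x y.
Proof.
rewrite !eqmE TZ; apply: dvdz_trans; exact: dvdz_mull.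
Qed.

Lemma cprofile_step u n :
  cprofile u n.+1 - cprofile u n = if dynadj k l i u.1 then
    (eqm T (t0%:Z + e%:Z * n.+1%:Z) (u.2 - (dt u.1)%:Z))%:Z
    - (eqm T (t0%:Z + e%:Z * n.+1%:Z)
          (u.2 - (dt u.1)%:Z + (dspan k l i u.1)%:Z))%:Z else 0.
Proof.
rewrite /cprofile; case: ifP => // _; rewrite -dmult_ee PoszM.
pose F (q : nat) := (eqm T (t0%:Z + e%:Z * n.+1%:Z) (u.2 - (dt u.1)%:Z + q%:Z * e%:Z))%:Z.
have -> : \sum_(q < r u.1) (eqm T (t0%:Z + e%:Z * n%:Z)
    (u.2 - (dt u.1)%:Z + q%:Z * e%:Z))%:Z = \sum_(q < r u.1) F q.+1.
  by apply: eq_bigr => q _; congr (Posz (nat_of_bool _)); apply: eqm_sub; lia.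
by rewrite (sum_telescope F) /F mul0r addr0.
Qed.

Lemma cprofile_per u : cprofile u p = cprofile u 0.
Proof.
rewrite /cprofile; case: ifP => // _; apply: eq_bigr => q _.
congr (Posz (nat_of_bool _)); rewrite /eqm; congr (_ == _).
apply/eqP; rewrite -[_ == _]/(eqm T _ _) eqm_cycle eqmE subr0; exact: dvdzz.
Qed.

Lemma cprofile_ge0 u n : 0 <= cprofile u n.
Proof. by rewrite /cprofile; case: ifP => // _; apply: sumr_ge0. Qed.

Lemma cprofile_zero u : exists2 n, (n < p)%N & cprofile u n = 0.
Proof.
case: (eqVneq (cprofile u 0) 0) => [S0|]; first by exists 0%N => //; lia.
rewrite {1}/cprofile; case: ifP => // hu S0.
have [q0 hq0] : exists q0 : 'I_(r u.1),
    eqm T (t0%:Z + e%:Z * 0) (u.2 - (dt u.1)%:Z + q0%:Z * e%:Z).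
  apply/existsP; apply: contraNT S0; rewrite negb_exists => /forallP h.
  by rewrite big1 // => q _; rewrite (negPf (h q)).
have q0r := ltn_ord q0; have rp := dmult_lt u.1.
(* Position 0 is the q0-th of the window, so r - q0 is the first position past its end; it could
   re-enter only by wrapping around, which r < p excludes. *)
exists (r u.1 - q0)%N; first lia.
rewrite /cprofile hu big1 // => q _; have qr := ltn_ord q.
rewrite (_ : eqm _ _ _ = false) //; apply/negbTE/negP => h.
have : eqm p (r u.1)%:Z q%:Z.
  rewrite -eqm_cycle eqmE.
  have -> : t0%:Z + e%:Z * (r u.1)%:Z - (t0%:Z + e%:Z * q%:Z)
    = (t0%:Z + e%:Z * (r u.1 - q0)%N%:Z - (u.2 - (dt u.1)%:Z + q%:Z * e%:Z))
      - (t0%:Z + e%:Z * 0 - (u.2 - (dt u.1)%:Z + q0%:Z * e%:Z)).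
    by rewrite -subzn; [ring|lia].
  by rewrite rpredB // -eqmE.
by rewrite eqm_small; lia.
Qed.

Lemma eqm_cvert (x y : int) :
  eqm T ((t0%:Z + e%:Z * y) %% T)%Z (((t0%:Z + e%:Z * x) %% T)%Z + e%:Z) = eqm p y (x + 1).
Proof.
rewrite eqm_modl (@eqm_sub _ _ _ (t0%:Z + e%:Z * (y - 1)) ((t0%:Z + e%:Z * x) %% T)%Z).
  by rewrite eqm_modr eqm_cycle; apply: eqm_sub; ring.
by ring.
Qed.

Lemma eqm_emod (x y : int) : eqm e (x %% T)%Z y = eqm e x y.
Proof.
rewrite !eqmE; have := divz_eq x T%:Z; set q := (_ %/ _)%Z; set z := (_ %% _)%Z => E.
have -> : x - y = (z - y) + q * p%:Z * e%:Z by rewrite E TZ; ring.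
have h : (e%:Z %| q * p%:Z * e%:Z)%Z by apply: dvdz_mull.
by rewrite (rpredDr _ h).
Qed.

Lemma cvert_balanced : balanced_cycle vs (epsQ k l T) p cvert cprofile.
Proof.
split=> //.
- exact: verts_uniq.
- exact: cvert_mem.
- exact: cvert_per.
- move=> x y hx hy /eqP; rewrite cvert_eq eqm_ltn //; exact: eqP.
- by move=> u v _ _; rewrite /epsQ opprB.
- move=> x y hx hy; rewrite /cvert /nrm /= epsQ_same // !eqm_cvert !eqm_succ //.
  by rewrite [(x == 1%N) && _]andbC; lia.
- move=> [j t] uV uP n hn; rewrite mem_verts /= in uV; have /andP[hj ht] := uV.
  have [n' nE] : exists n', n = n'.+1 by exists n.-1; lia.
  rewrite /cvert /nrm /=; case: (eqVneq j i) => [jE|ji].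
    (* Here u lies on another cycle with the same i: its time is in a different class modulo e, so
       no arrow joins it to this one. *)
    rewrite {}jE in uP *; rewrite mem_cycle // eqxx /= in uP.
    rewrite epsQ_same // /cprofile /= dynadj_irrefl if_same subrr.
    have H x : eqm T x t -> eqm e x t0%:Z -> False.
      move=> /eqm_dvd h1 h2; move: uP; rewrite eqmE => /negP; apply.
      rewrite (_ : t - t0%:Z = (x - t0%:Z) - (x - t)); last by ring.
      by rewrite rpredB // -eqmE.
    rewrite (_ : eqm T _ _ = false) 1?(_ : eqm T t _ = false) //.
    + apply/negP; rewrite eqm_sym => /H; apply; rewrite eqmE addrAC rpredDr ?dvdzz // -eqmE.
      by rewrite eqm_emod eqmE addrAC subrr add0r dvdz_mulr.
    + apply/negP; rewrite (@eqm_sub _ _ _ (((t0%:Z + e%:Z * n%:Z) %% T)%Z - e%:Z) t) => [/H|]; last by ring.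
      apply; rewrite eqmE addrAC rpredBr ?dvdzz // -eqmE.
      by rewrite eqm_emod eqmE addrAC subrr add0r dvdz_mulr.
  have := cprofile_step (j, t) n'; rewrite epsQ_neq //= -nE eqm_modl eqm_modl => <-.
  congr (_ - _); last by rewrite nE.
  by case: eqP => [->|//]; rewrite cprofile_per.
- by move=> u _ _ n _; apply: cprofile_ge0.
- by move=> u _ _; apply: cprofile_zero.
Qed.

End QuiverCycle.

(** * Matching the explicit formulas *)

Lemma eqm1 a b : eqm 1 a b = true.
Proof. by rewrite eqmE dvd1z. Qed.

Lemma exprz_sum (K : fieldType) (x : K) (n : nat) (b : 'I_n -> int) : x != 0 ->
  x ^ (\sum_(q < n) b q) = \prod_(q < n) x ^ b q.
Proof. by move=> x0; apply: (big_morph (fun z => x ^ z)) => // y z; apply: expfzDr. Qed.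

Lemma eqm_subself T (t s : int) : eqm T (t - T%:Z) s = eqm T t s.
Proof.
rewrite !eqmE (_ : t - T%:Z - s = t - s - T%:Z); last by ring.
by rewrite rpredBr // dvdzz.
Qed.

Ltac decide_eqm T :=
  repeat match goal with
  | |- context [eqm T ?a ?b] =>
      first [rewrite (_ : eqm T a b = true); last by rewrite eqm_small; lia
            |rewrite (_ : eqm T a b = false); last by rewrite eqm_small; lia]
  end.

Ltac norm_nat :=
  repeat match goal with
  | |- context [(maxn ?a ?b %/ ?c)%N] =>
      let n := eval vm_compute in (maxn a b %/ c)%N in change (maxn a b %/ c)%N with n
  | |- context [maxn ?a ?b] =>
      let n := eval vm_compute in (maxn a b) in change (maxn a b) with n
  end.

Ltac norm_arg t a :=
  lazymatch a with
  | t => fail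
  | t + Posz (S _) => fail
  | t + Negz _ => fail
  | _ => let f := eval pattern t in a in
         lazymatch f with
         | ?g _ => let c := eval vm_compute in (g (Posz O)) in
                   lazymatch c with
                   | Posz O => replace a with t by lia
                   | _ => replace a with (t + c) by lia
                   end
         end
  end.

Ltac finish_X T F Z t F0 :=
  rewrite /=; decide_nat; decide_eqm T; rewrite /= ?andbF ?andbT /= ?eqm1 /=;
  norm_nat; rewrite ?subr0 ?eqm_subself;
  repeat match goal with |- context [eqm ?T ?a ?b] => case: (eqm T a b) end;
  rewrite /= ?big_ord_recl ?big_ord0 /= /bump /=;
  repeat match goal with
  | |- context [F ?a] => norm_arg t a
  | |- context [Z _ ?a] => norm_arg t a
  end; first [done | by field; rewrite ?F0].

Section Transformation.
Variables (K : fieldType) (pos : K -> Prop).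
Hypothesis sfK : semifield pos.
Variables (k : ltype) (l m i t0 : nat).
Hypotheses (vk : valid_type k l) (m_gt1 : (1 < m)%N) (hi : (1 <= i <= l)%N).
Variable x : V -> K.
Hypothesis x_pos : forall u, pos (x u).

Local Notation T := (Tn k m).
Local Notation e := (ee k l i).
Local Notation p := (T %/ e)%N.
Local Notation vs := (verts l T).
Local Notation dt j := (doffset k l i j).
Local Notation r j := (dmult k l i j).
Local Notation w := (cvert k l m i t0).
Local Notation f := (fX k l m x i).
Local Notation P := (cycle_seq w p).

Let X z := x (w z).

Lemma fX_cycf (t z : int) : eqm T t (t0%:Z + e%:Z * z) -> f t = cycf p X z.
Proof.
move=> E; rewrite /fX /cycf; congr (_ + _); apply: eq_bigr => c _.
apply: eq_bigr => q _; rewrite /X; congr x; apply/eqP; rewrite nrm_eq.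
by rewrite (eqm_sub _ (c := t) (d := t0%:Z + e%:Z * z)) // PoszM; ring.
Qed.

Lemma x_cvert (t z : int) : eqm T t (t0%:Z + e%:Z * z) -> x (nrm T (i, t)) = X z.
Proof. by move=> E; congr x; apply/eqP; rewrite nrm_eq. Qed.

Lemma fX_pos t : pos (f t).
Proof.
by apply: (pos_addsum sfK) => [|c]; [exact: pos_1|apply: (pos_prod sfK)].
Qed.

Lemma fX_neq0 t : f t != 0. Proof. exact: (pos_neq0 sfK) (fX_pos t). Qed.

Definition gX (t : int) : K := x (nrm T (i, t)) * f (t - e%:Z) / f t.

Lemma gX_cycg (t z : int) : eqm T t (t0%:Z + e%:Z * z) -> gX t = cycg p X z.
Proof.
move=> E; rewrite /gX /cycg (x_cvert E) (fX_cycf E); congr (_ * _ / _).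
by apply: fX_cycf; rewrite (eqm_sub _ (c := t) (d := t0%:Z + e%:Z * z)) //; ring.
Qed.

(** Common form of all the formulas off the cycle: a product of g over one window. It telescopes to
    the X-factors of the window times a quotient of two values of f, as in the stated cases. *)
Definition Xout (j : nat) (t : int) : K :=
  if dynadj k l i j && eqm e (t - (dt j)%:Z) t0%:Z
  then x (nrm T (j, t)) * \prod_(q < r j) gX (t - (dt j)%:Z + q%:Z * e%:Z)
  else x (nrm T (j, t)).

Let p_gt1 : (1 < p)%N := period_gt1 k l i m_gt1.

Lemma prod_cprofile j t : 0 <= t < T%:Z ->
  x (j, t) * \prod_(0 <= n < p) cycg p X n%:Z ^ cprofile k l m i t0 (j, t) n
  = Xout j t.
Proof.
move=> ht; have xE : x (nrm T (j, t)) = x (j, t) by rewrite /nrm /= modz_small.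
rewrite /Xout xE /cprofile /=; case: (dynadj k l i j) => /=; last first.
  by rewrite big1 ?mulr1 // => n _; rewrite expr0z.
have g0 n : cycg p X n != 0 by apply: (cycg_neq0 sfK) => z; apply: x_pos.
under eq_bigr => n _ do rewrite exprz_sum //.
(* The class of [t - doffset] modulo e selects the cycle that meets (j, t); for any other cycle no
   position matches. *)
rewrite exchange_big /=; case: ifP => ha; last first.
  rewrite big1 ?mulr1 // => q _; rewrite big1 // => n _.
  rewrite (_ : eqm T _ _ = false) ?expr0z //; apply/negP => /(@eqm_dvd k l m i) h.
  move/negP: ha; apply; move: h; rewrite !eqmE => h.
  have -> : t - (dt j)%:Z - t0%:Z = (n%:Z - q%:Z) * e%:Z
     - (t0%:Z + e%:Z * n%:Z - (t - (dt j)%:Z + q%:Z * e%:Z)) by ring.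
  have h3 : (e%:Z %| (n%:Z - q%:Z) * e%:Z)%Z by apply: dvdz_mull.
  exact: rpredB h3 h.
congr (_ * _); apply: eq_bigr => q _.
have [z zE] : exists z, t - (dt j)%:Z + q%:Z * e%:Z = t0%:Z + e%:Z * z.
  move: ha; rewrite eqmE => /dvdzP[z zE]; exists (z + q%:Z).
  by rewrite mulrDr [_ * z]mulrC -zE; ring.
pose n0 := `|(z %% p)%Z|%N.
have h1 : 0 <= (z %% p)%Z by rewrite modz_ge0; lia.
have h2 : (z %% p)%Z < p%:Z by rewrite ltz_pmod; lia.
have n0E : n0%:Z = (z %% p)%Z by rewrite /n0; lia.
rewrite zE (@gX_cycg _ n0%:Z); last by rewrite eqm_cycle // n0E eqm_modr eqm_refl.
transitivity (\prod_(0 <= n < p) cycg p X n%:Z ^ (n == n0)%:Z).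
  rewrite !big_nat; apply: eq_bigr => n hn; congr (_ ^ (Posz (nat_of_bool _))).
  by rewrite eqm_cycle // -eqm_modr -n0E eqm_small; lia.
apply: (@prod_exprz_delta _ _ _ (fun n => cycg p X n%:Z)); first exact: iota_uniq.
by rewrite mem_index_iota; lia.
Qed.

Lemma Xnew_in t : eqm e t t0%:Z ->
  Xnew k l m i t0 x i t = f t / (x (nrm T (i, t - e%:Z)) * f (t - 2 * e%:Z)).
Proof. by move=> ht; rewrite /Xnew leqnn eqxx ht. Qed.

Lemma Xnew_out j t : (1 <= j <= l)%N -> ~~ ((j == i) && eqm e t t0%:Z) ->
  Xnew k l m i t0 x j t = Xout j t.
Proof.
move=> hj nin; rewrite /Xnew /Xout /gX; cbv zeta; rewrite (negPf nin).
move: (fX k l m x i) (fX_neq0) => F F0.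
pose Y j t := x (nrm T (j, t)).
have YE j' t' : x (nrm T (j', t')) = Y j' t' by [].
rewrite !YE; under eq_bigr => q _ do rewrite YE.
(* This bound lets [eqm_small] separate the constant shifts occurring in the arrows. *)
have hT : (unitc k * 2 <= T)%N by rewrite leq_mul2l m_gt1 orbT.
move: (Y) (T) hT => Z T' hT {YE Y}; clear p_gt1 X x_pos sfK m_gt1.
rewrite /dmult /doffset /dspan /narr /ee /cedge; rewrite /ee in nin.
case: k vk hT nin => vk' hT nin; rewrite /= in hT.
1,4,5: rewrite ?(dynadjC _ l j i); case: (ltngtP j i) nin => [hij|hij|-> /=] nin;
  rewrite ?eqm1 // in nin *; rewrite ?dynadj_irrefl /=;
  case: (dynadj _ _ _ _); by finish_X T' F Z t F0.
- case: (ltnP i l) nin => il; case: (ltnP j l) => jl; case: (ltngtP j i) => hij;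
  try (by exfalso; lia); case: (eqVneq i j.+1) => hij1; case: (eqVneq j i.+1) => hij2;
  try (by exfalso; lia); rewrite /= ?eqm1 // => nin; rewrite /dynadj;
  by finish_X T' F Z t F0.
- case: (ltnP i l) nin => il; case: (ltnP j l) => jl; case: (ltngtP j i) => hij;
  try (by exfalso; lia); case: (eqVneq i j.+1) => hij1; case: (eqVneq j i.+1) => hij2;
  try (by exfalso; lia); rewrite /= ?eqm1 // => nin; rewrite /dynadj;
  by finish_X T' F Z t F0.
- have hi' := hi; rewrite (eqP vk') in hi' hj *; have [] := ord_cases4 hi'; have [] := ord_cases4 hj;
    move=> Ej Ei; rewrite Ei Ej in nin *; rewrite /= ?eqm1 // in nin *; by finish_X T' F Z t F0.
- have hi' := hi; rewrite (eqP vk') in hi' hj *; have [] := ord_cases2 hi'; have [] := ord_cases2 hj;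
    move=> Ej Ei; rewrite Ei Ej in nin *; rewrite /= ?eqm1 // in nin *; by finish_X T' F Z t F0.
Qed.

End Transformation.

(** * The A-variable formulas *)

Lemma prod_pred1_seq (K : fieldType) (s : seq nat) (c : nat) (H : nat -> K) :
  uniq s -> \prod_(j <- s | j == c) H j = if c \in s then H c else 1.
Proof.
move=> us; case: ifP => cs.
  by rewrite -big_filter (filter_pred1_uniq us cs) big_seq1.
rewrite big_seq_cond big1 // => j /andP[js /eqP jc].
by rewrite -jc js in cs.
Qed.

Lemma prod_chain (K : fieldType) (l i : nat) (H : nat -> K) (Q : pred nat) :
  (1 <= i <= l)%N ->
  {in iota 1 l, forall j, Q j = (j == i.+1) || (j == i.-1)} ->
  \prod_(j <- iota 1 l | Q j) H j
  = (if (1 <= i.+1 <= l)%N then H i.+1 else 1)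
    * (if (1 <= i.-1 <= l)%N then H i.-1 else 1).
Proof.
move=> hi QE; rewrite big_seq_cond.
rewrite (eq_bigl (fun j => (j \in iota 1 l) && ((j == i.+1) || (j == i.-1)))); last first.
  by move=> j; case jl: (j \in _) => //=; apply: QE.
rewrite -big_seq_cond (bigID (fun j => j == i.+1)) /=.
rewrite (eq_bigl (fun j => j == i.+1)); last by move=> j; lia.
rewrite [X in _ * X](eq_bigl (fun j => j == i.-1)); last by move=> j; lia.
by rewrite !prod_pred1_seq ?iota_uniq // !mem_iota add1n.
Qed.

Ltac finish_A Y t :=
  rewrite /=; decide_nat; rewrite /=; norm_nat;
  rewrite ?big_ord_recl ?big_ord0 /= /bump /=;
  repeat match goal with |- context [Y _ ?c] => norm_arg t c end; ring.

Section ATransformation.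
Variables (K : fieldType) (k : ltype) (l m i t0 : nat).
Hypotheses (vk : valid_type k l) (m_gt1 : (1 < m)%N) (hi : (1 <= i <= l)%N).
Variable a : V -> K.
Hypothesis a_neq0 : forall u, a u != 0.

Local Notation T := (Tn k m).
Local Notation e := (ee k l i).
Local Notation p := (T %/ e)%N.
Local Notation vs := (verts l T).
Local Notation dt j := (doffset k l i j).
Local Notation r j := (dmult k l i j).
Local Notation w := (cvert k l m i t0).
Local Notation P := (cycle_seq w p).
Local Notation ts := [seq t%:Z | t <- iota 0 T & eqm e t%:Z t0%:Z].

Let T_gt0 : (0 < T)%N.
Proof. by rewrite /Tn muln_gt0; case: (k) => /=; lia. Qed.
Let p_gt1 : (1 < p)%N := period_gt1 k l i m_gt1.

(** The summand of f_A seen from the cycle: the vertices (j, s) whose window contains time t are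
    those with s = t + offset - q e modulo T, q < [dmult]. *)
Definition hA (t : int) : K :=
  (a (nrm T (i, t)) * a (nrm T (i, t + e%:Z)))^-1
  * \prod_(j <- iota 1 l | dynadj k l i j)
      \prod_(q < r j) a (nrm T (j, t + (dt j)%:Z - q%:Z * e%:Z)).

Lemma prod_cprofile_out n :
  \prod_(u <- vs | u \notin P) a u ^ cprofile k l m i t0 u n
  = \prod_(j <- iota 1 l | dynadj k l i j)
      \prod_(q < r j) a (nrm T (j, t0%:Z + e%:Z * n%:Z + (dt j)%:Z - q%:Z * e%:Z)).
Proof.
rewrite big_mkcond (eq_bigr (fun u => a u ^ cprofile k l m i t0 u n)); last first.
  move=> u _; case: ifP => // /negbFE /mapP[c _ ->].
  by rewrite /cprofile /= dynadj_irrefl expr0z.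
rewrite /verts big_allpairs_dep [RHS]big_mkcond; apply: eq_bigr => j _.
rewrite /cprofile /=; case: ifP => hj; last by rewrite big1 // => t _; rewrite expr0z.
under eq_bigr => t _ do rewrite exprz_sum //.
rewrite exchange_big; apply: eq_bigr => q _.
set y := t0%:Z + _ + _ - _.
pose n1 := `|(y %% T)%Z|%N.
have h1 : 0 <= (y %% T)%Z by rewrite modz_ge0; lia.
have h2 : (y %% T)%Z < T%:Z by rewrite ltz_pmod; lia.
have n1E : n1%:Z = (y %% T)%Z by rewrite /n1; lia.
rewrite /nrm /= -n1E.
transitivity (\prod_(t <- iota 0 T) a (j, t%:Z) ^ (t == n1)%:Z).
  rewrite !big_seq; apply: eq_bigr => t; rewrite mem_iota => ht.
  congr (_ ^ (Posz (nat_of_bool _))).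
  rewrite eqm_sym (@eqm_sub _ _ _ t%:Z y); last by rewrite /y; ring.
  by rewrite -eqm_modr -n1E eqm_small; lia.
apply: (@prod_exprz_delta _ _ _ (fun t => a (j, t%:Z))); first exact: iota_uniq.
by rewrite mem_iota; lia.
Qed.

Lemma hA_per (x y : int) : eqm T x y -> hA x = hA y.
Proof.
move=> E; have nE j c : nrm T (j, x + c) = nrm T (j, y + c).
  by apply/eqP; rewrite nrm_eq; move: E; rewrite !eqmE (_ : x + c - (y + c) = x - y) //; ring.
have nE0 : nrm T (i, x) = nrm T (i, y) by rewrite -[x]addr0 nE addr0.
rewrite /hA nE0 nE; congr (_ * _); apply: eq_bigr => j _; apply: eq_bigr => q _.
by rewrite -!addrA nE.
Qed.

Lemma sum_cycle_hA : \sum_(n < p) hA (t0%:Z + e%:Z * n%:Z) = \sum_(t <- ts) hA t.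
Proof.
transitivity (\sum_(n <- [seq (w n%:Z).2 | n <- iota 0 p]) hA n).
  rewrite big_map.
  have -> : \sum_(n <- iota 0 p) hA (w n%:Z).2 = \sum_(0 <= n < p) hA (w n%:Z).2.
    by rewrite /index_iota subn0.
  rewrite big_mkord; apply: eq_bigr => n _.
  by apply: hA_per; rewrite /cvert /= eqm_modr eqm_refl.
apply: perm_big; apply: uniq_perm.
- rewrite map_inj_in_uniq ?iota_uniq // => x y; rewrite !mem_iota => hx hy E.
  have : w x%:Z == w y%:Z by rewrite xpair_eqE /= eqxx; apply/eqP.
  by rewrite cvert_eq // eqm_small; lia.
- by rewrite map_inj_uniq ?filter_uniq ?iota_uniq // => x y [].
move=> t; apply/idP/idP.
- case/mapP => n _ ->; have := cvert_mem t0 vk m_gt1 hi n%:Z; rewrite mem_verts => /andP[_ ht].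
  have wP := cvert_in t0 vk m_gt1 hi n%:Z.
  move: wP ht; case wE: (w n%:Z) => [j t'] wP /= ht.
  rewrite mem_cycle // in wP; case/andP: wP => _ et.
  apply/mapP; exists `|t'|%N; last by lia.
  by rewrite mem_filter mem_iota (_ : Posz _ = t') ?et; lia.
- case/mapP => t'; rewrite mem_filter mem_iota => /andP[et ht] ->.
  have : (i, t'%:Z) \in P by rewrite mem_cycle ?eqxx ?et //; lia.
  case/mapP => c; rewrite mem_iota => hc E.
  apply/mapP; exists (c %% p)%N.
    by rewrite mem_iota add0n ltn_mod; lia.
  have -> : w (c %% p)%N%:Z = w c%:Z; last by rewrite -E.
  by apply/eqP; rewrite cvert_eq // /eqm -modz_nat modz_mod.
Qed.

Let Z (j : nat) (t : int) : K := if (1 <= j <= l)%N then a (nrm T (j, t)) else 1.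

Let ZE j t : (1 <= j <= l)%N -> Z j t = a (nrm T (j, t)).
Proof. by rewrite /Z => ->. Qed.

(** A window of length one gives a single factor per neighbour; the offset places it at n for larger
    labels and at n + d_i for smaller ones. *)
Lemma hA_generic t :
  (forall j, (1 <= j <= l)%N -> dynadj k l i j ->
     r j = 1%N /\ dt j = if (j < i)%N then e else 0%N) ->
  (Z i t * Z i (t + e%:Z))^-1
       * \prod_(j <- iota 1 l | dynadj k l i j && (i < j)%N) Z j t
       * \prod_(j <- iota 1 l | dynadj k l i j && (j < i)%N) Z j (t + e%:Z) = hA t.
Proof.
move=> H; rewrite !ZE // /hA -mulrA; congr (_ * _); symmetry.
rewrite (bigID (fun j => i < j)%N) /=.
rewrite big_seq_cond [in RHS]big_seq_cond; congr (_ * _).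
  apply: eq_bigr => j; rewrite mem_iota => /and3P[jl adj ij].
  have [|-> ->] := H j _ adj; first by lia.
  rewrite (_ : (j < i)%N = false); last lia.
  by rewrite big_ord_recl big_ord0 mulr1 ZE ?mul0r ?subr0 ?addr0 //; lia.
rewrite big_seq_cond [in RHS]big_seq_cond; apply: eq_big.
  move=> j; case: (eqVneq j i) => [->|ji]; first by rewrite dynadj_irrefl.
  by congr (_ && (_ && _)); lia.
move=> j; rewrite mem_iota => /and3P[jl adj ij].
have ji : (j < i)%N by move: adj ij; case: (ltngtP j i) => // ->; rewrite dynadj_irrefl.
have [|-> ->] := H j _ adj; first by lia.
by rewrite ji big_ord_recl big_ord0 mulr1 ZE ?mul0r ?subr0 //; lia.
Qed.

Lemma dynadj_chain : isB k || isC k || isF k || isG k ->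
  {in iota 1 l, forall j, dynadj k l i j = (j == i.+1) || (j == i.-1)}.
Proof.
move=> hk j; rewrite mem_iota => hj; rewrite /dynadj.
by case: (k) hk => // _; case: (ltngtP i j) => ij; lia.
Qed.

Lemma hA_chain t : isB k || isC k || isF k || isG k ->
  hA t = (Z i t * Z i (t + e%:Z))^-1
    * ((if (1 <= i.+1 <= l)%N then
          \prod_(q < r i.+1) Z i.+1 (t + (dt i.+1)%:Z - q%:Z * e%:Z) else 1)
       * (if (1 <= i.-1 <= l)%N then
          \prod_(q < r i.-1) Z i.-1 (t + (dt i.-1)%:Z - q%:Z * e%:Z) else 1)).
Proof.
move=> hk; rewrite !ZE // /hA; congr (_ * _).
rewrite (prod_chain _ hi (dynadj_chain hk)); congr (_ * _); case: ifP => // h;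
  by apply: eq_bigr => q _; rewrite ZE.
Qed.

Lemma fA_hA : fA k l m i t0 a = \sum_(t <- ts) hA t.
Proof.
rewrite /fA; cbv zeta.
have AE j t : (if (1 <= j <= l)%N then a (nrm T (j, t)) else 1) = Z j t by [].
have Zout j t : ~~ (1 <= j <= l)%N -> Z j t = 1 by rewrite /Z => /negPf ->.
case: ifP => [h1|h1].
  apply: eq_bigr => t _; rewrite !AE hA_chain; last by move: h1; case: (k).
  move: (Z) Zout {AE} => Y Yout; rewrite /dmult /doffset /dspan /ee; clear p_gt1 T_gt0.
  case: (k) h1 vk => //= h1 vk'.
    have iE : i = (l - 1)%N by move: h1; rewrite orbF => /eqP.
    (* For l = 2 the index i - 1 is 0, and the corresponding variable is read as 1. *)
    case: (ltnP 0 i.-1) => h0; last rewrite [Y i.-1 _]Yout; last lia.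
      by finish_A Y t.
    by finish_A Y t.
  by rewrite (eqP h1); rewrite (eqP vk') in Yout *; finish_A Y t.
case: ifP => [h2|h2].
  have [kB iE] : isB k /\ i = l by move: h2; case: (k) => //= /eqP.
  apply: eq_bigr => t _; rewrite !AE hA_chain; last by rewrite kB.
  move: (Z) Zout {AE} => Y Yout; rewrite /dmult /doffset /dspan /ee; clear p_gt1 T_gt0.
  rewrite subn1 -iE; case: (k) kB vk => //= _ vk'.
  by finish_A Y t.
case: ifP => [h3|h3].
  have [kC iE] : isC k /\ i = (l - 1)%N by move: h3; case: (k) => //= /eqP.
  have [l1 l2 l3] : [/\ (l - 1 = i)%N, (l - 2 = i.-1)%N & l = i.+1] by split; lia.
  apply: eq_bigr => t _; rewrite !AE hA_chain; last by rewrite kC orbT.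
  move: (Z) Zout {AE} => Y Yout; rewrite /dmult /doffset /dspan /ee; clear p_gt1 T_gt0.
  rewrite l1 l2 {1 2}l3; case: (k) kC vk => //= _ vk'.
  case: (ltnP 0 i.-1) => h0; last rewrite [Y i.-1 _]Yout; last lia.
    by finish_A Y t.
  by finish_A Y t.
case: ifP => [h4|h4].
  have [kF iE] : isF k /\ i = 3%N by move: h4; case: (k) => //= /eqP.
  apply: eq_bigr => t _; rewrite !AE hA_chain; last by rewrite kF !orbT.
  move: (Z) Zout {AE} => Y Yout; rewrite /dmult /doffset /dspan /ee; clear p_gt1 T_gt0.
  rewrite iE; case: (k) kF vk => //= _ /eqP ->.
  by finish_A Y t.
case: ifP => [h5|h5].
  have [kG iE] : isG k /\ i = 1%N by move: h5; case: (k) => //= /eqP.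
  apply: eq_bigr => t _; rewrite !AE hA_chain; last by rewrite kG !orbT.
  move: (Z) Zout {AE} => Y Yout; rewrite /dmult /doffset /dspan /ee; clear p_gt1 T_gt0.
  rewrite iE; case: (k) kG vk => //= _ /eqP ->.
  by finish_A Y t.
(* In the cases left, no neighbour of i has a longer root and no half-step shift occurs, so every
   window has length one. *)
apply: eq_bigr => t _; apply: hA_generic => j hj adj.
have ji : j != i by apply: contraTneq adj => ->; rewrite dynadj_irrefl.
move: adj h1 h2 h3 h4 h5; clear p_gt1 T_gt0; have hi' := hi.
case: (k) vk => vk'; rewrite /dmult /doffset /dspan /ee /= => adj h1 h2 h3 h4 h5.
1,4,5: by rewrite /=; case: ifP.
- have adj' : j = i.+1 \/ i = j.+1 by move: adj; rewrite /dynadj; case: (ltngtP i j) ji => // *; lia.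
  have [-> ->] : (i < l)%N /\ (j < l)%N by move: h1 h2; rewrite ?orbF => /eqP h1 /eqP h2; lia.
  by case: ifP.
- have adj' : j = i.+1 \/ i = j.+1 by move: adj; rewrite /dynadj; case: (ltngtP i j) ji => // *; lia.
  have [il|[iE jE]] : (i.+1 < l)%N \/ i = l /\ j = l.-1 by move/eqP: h3 => h3; lia.
    have [-> ->] : (i < l)%N /\ (j < l)%N by lia.
    by case: ifP.
  have [il [jl jl']] : (i < l)%N = false /\ (j < l)%N = true /\ (j < i)%N = true by split; lia.
  by rewrite il jl jl'.
- rewrite (eqP vk') in hi' hj adj.
  by have [] := ord_cases4 hi'; have [] := ord_cases4 hj => Ej Ei; rewrite Ei Ej in h1 h4 adj *.
- rewrite (eqP vk') in hi' hj adj.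
  by have [] := ord_cases2 hi'; have [] := ord_cases2 hj => Ej Ei; rewrite Ei Ej in h5 adj *.
Qed.

End ATransformation.

Section RmutQuiver.
Variables (K : fieldType) (pos : K -> Prop).
Hypothesis sfK : semifield pos.
Variables (k : ltype) (l m i t0 : nat).
Hypotheses (vk : valid_type k l) (m_gt1 : (1 < m)%N) (hi : (1 <= i <= l)%N).
Variable s : seed K.
Hypotheses (seps_s : seps s = epsQ k l (Tn k m)) (pos_s : pos_seed pos s).

Local Notation T := (Tn k m).
Local Notation e := (ee k l i).
Local Notation p := (T %/ e)%N.
Local Notation w := (cvert k l m i t0).
Local Notation P := (cycle_seq w p).
Let s' := Rmut (verts l T) (cyc k l m i t0) s.

Let x_pos u : pos (sx s u). Proof. exact: (proj1 pos_s). Qed.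
Let a_neq0 u : sa s u != 0. Proof. exact: (pos_neq0 sfK) (proj2 pos_s u). Qed.

Let bc : balanced_cycle (verts l T) (seps s) p w (cprofile k l m i t0).
Proof. by rewrite seps_s; apply: cvert_balanced. Qed.

Lemma mem_cycleP (t : int) : 0 <= t < T%:Z -> eqm e t t0%:Z ->
  exists2 c : nat, (0 < c <= p)%N & (i, t) = w c%:Z /\ eqm T t (t0%:Z + e%:Z * c%:Z).
Proof.
move=> ht et; have : (i, t) \in P by rewrite mem_cycle ?eqxx ?et.
case/mapP => c; rewrite mem_iota => hc E; exists c; first lia.
by split=> //; case: E => ->; rewrite eqm_modl eqm_refl.
Qed.

Lemma Rmut_quiver_x j (t : int) : (1 <= j <= l)%N -> 0 <= t < T%:Z ->
  sx s' (j, t) = Xnew k l m i t0 (sx s) j t.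
Proof.
move=> hj ht; have [_ Hin Hout _ _] := Rmut_balanced sfK bc pos_s.
rewrite /s' cyc_cvert; case: (boolP ((j == i) && eqm e t t0%:Z)) => [/andP[/eqP -> et]|nin].
  rewrite Xnew_in //; have [c hc [-> tE]] := mem_cycleP ht et.
  have shift (d : int) : eqm T (t - d * e%:Z) (t0%:Z + e%:Z * (c%:Z - d)).
    by rewrite (eqm_sub _ (c := t) (d := t0%:Z + e%:Z * c%:Z)) //; ring.
  rewrite Hin // -(fX_cycf _ tE).
  rewrite -(fX_cycf (sx s) (shift 2)) -(@x_cvert _ k l m i t0 (sx s) _ _ (shift 1)) mul1r.
  by [].
rewrite (Xnew_out sfK) // -(prod_cprofile sfK t0 vk) //; apply: Hout.
  by rewrite mem_verts hj.
by rewrite mem_cycle.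
Qed.

Lemma Rmut_quiver_a j (t : int) : (1 <= j <= l)%N -> 0 <= t < T%:Z ->
  sa s' (j, t) = Anew k l m i t0 (sa s) j t.
Proof.
move=> hj ht; have [_ _ _ Hin Hout] := Rmut_balanced sfK bc pos_s.
have nE : nrm T (j, t) = (j, t) by rewrite /nrm /= modz_small.
rewrite /s' cyc_cvert /Anew nE.
case: (boolP ((j == i) && eqm e t t0%:Z)) => [/andP[/eqP -> et]|nin]; last first.
  by apply: Hout; [rewrite mem_verts hj|rewrite mem_cycle].
have [c hc [-> _]] := mem_cycleP ht et; rewrite Hin // mulrC; congr (_ * _).
rewrite fA_hA // -(sum_cycle_hA t0 vk) //; apply: eq_bigr => n _.
rewrite prod_cprofile_out // /hA; congr ((_ * sa s _)^-1 * _).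
by rewrite /cvert; congr (nrm T (i, _)); rewrite -addn1 PoszD; ring.
Qed.

Lemma Rmut_quiver_eps : {in verts l T &, forall u v, seps s' u v = seps s u v}.
Proof. by rewrite /s' cyc_cvert; have [] := Rmut_balanced sfK bc pos_s. Qed.

End RmutQuiver.

Local Close Scope ring_scope.

Theorem theorem3p3 (k : ltype) (l m i t0 : nat) :
  valid_type k l -> 1 < m -> 1 <= i <= l -> t0 < Tn k m ->
  let T := Tn k m in
  let s0 := seed0 k l m in
  let s := Rmut (verts l T) (cyc k l m i t0) s0 in
  [/\ forall u v, u \in verts l T -> v \in verts l T -> seps s u v = seps s0 u v,
      forall (j t : nat), 1 <= j <= l -> t < T ->
        sx s (j, Posz t) = Xnew k l m i t0 (sx s0) j (Posz t)
    & forall (j t : nat), 1 <= j <= l -> t < T ->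
        sa s (j, Posz t) = Anew k l m i t0 (sa s0) j (Posz t)].
Proof.
move=> vk m_gt1 hi ht0 T s0 s.
have sfK := frac_pos_semifield (NV l T).
have pos_s : pos_seed (@frac_pos (NV l T)) s0 by split=> u; apply: frac_pos_var.
have sE : seps s0 = epsQ k l T by [].
split=> [u v uV vV|j t hj ht|j t hj ht].
- exact: (Rmut_quiver_eps sfK t0 vk m_gt1 hi sE pos_s).
- by apply: (Rmut_quiver_x sfK t0 vk m_gt1 hi sE pos_s) => //=; lia.
- by apply: (Rmut_quiver_a sfK t0 vk m_gt1 hi sE pos_s) => //=; lia.
Qed.
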